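(* For every integer $n\ge 0$ the following identities hold: $$K_n^2=K_{n+3}-(n+2)K_{n+1},$$ $$K_n^3=K_{n+5}-(3n+8)K_{n+3},$$ $$K_n^4=K_{n+7}-(6n+20)K_{n+5}+3(n+2)(n+4)K_{n+3},$$ $$K_n^5=K_{n+9}-(10n+40)K_{n+7}+(15n^2+110n+184)K_{n+5}.$$ Here $K_m$ (one index) are the Bernoulli-Euler numbers and $K_n^l$ (two indices) are the numbers of connected components of the sets of very nice M-morsifications of $B_n^l$.
   Context: The Bernoulli-Euler numbers $K_m$, $m\ge0$, are defined by $\sec t+\tan t=\sum_{m\ge0}K_m t^m/m!$ (so $1,1,1,2,5,16,61,\dots$). For an integer $n\ge 1$ let $P_n$ be the space of real polynomials of the form $x^n+\lambda_2x^{n-2}+\cdots+\lambda_{n-1}x$, with the topology of the coefficients $\lambda_i\in\mathbb R$ (so $P_1=\{x\}$, $P_2=\{x^2\}$). For $l\ge 0$ consider pairs $(f;b_1,\dots,b_l)\in P_n\times\mathbb R^l$; the $b_i$ are the (labelled) boundary points and the numbers $f(b_i)$ are the boundary values. Such a pair is a very nice M-morsification of $B_n^l$ if all $n-1$ critical points of $f$ (counted with multiplicity) are real and the $n-1$ critical values together with the $l$ boundary values are all pairwise distinct. $K_n^l$ is the number of connected components of the set of very nice M-morsifications of $B_n^l$, as a subspace of $P_n\times\mathbb R^l$. For $n=0$, $K_0^l$ (for $l\ge1$) is the number of connected components of the space of degree $0$ polynomials (the zero polynomial) with $l$ labelled real boundary points having pairwise distinct boundary values; thus $K_0^1=1$ and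 $K_0^l=0$ for $l\ge 2$. It is known (Arnold) that $K_n^0=K_{n-1}$ for $n\ge1$ and $K_n^1=K_{n+1}$ for $n\ge0$. *)

(* Defs.v *)
From mathcomp Require Import all_boot all_order all_algebra.
From mathcomp Require Import all_classical all_reals all_analysis.

Set Implicit Arguments.
Unset Strict Implicit.
Unset Printing Implicit Defensive.

Import Order.TTheory GRing.Theory Num.Theory.
Import numFieldNormedType.Exports.

Local Open Scope classical_set_scope.
Local Open Scope ring_scope.

(* sec t + tan t = \sum_m K_m t^m / m! for all t in a neighbourhood of 0; this
   determines K. *)
Definition bernoulli_euler (R : realType) (K : nat -> R) : Prop :=
  \forall t \near (0 : R),
    pseries (fun m => K m / m`!%:R) t @ \oo --> (cos t)^-1 + tan t.

(* The element of P_n with coefficients lam: lam 0 i is \lambda_{i+2}, the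
   coefficient of x^(n-2-i), so that there are n-2 free coefficients for n >= 2
   and none for n <= 1. For n = 0 the only element is the zero polynomial. *)
Definition Ppoly (R : realType) (n : nat) (lam : 'rV[R]_(n.-2)) : {poly R} :=
  if n == 0%N then 0
  else 'X^n + \sum_(i < n.-2) lam 0 i *: 'X^(n.-2 - i).
Arguments Ppoly {R} n lam.

(* The pairs (lam, b) in P_n x R^l, where P_n carries the topology of its
   coefficients; c lists the n-1 critical points, with multiplicity. For n = 0
   the polynomial is 0, c is empty and the equation on the derivative reads
   0 = 0, so only the condition on the boundary values remains. *)
Definition very_nice (R : realType) (n l : nat) :
    set ('rV[R]_(n.-2) * 'rV[R]_l) :=
  [set p : 'rV[R]_(n.-2) * 'rV[R]_l |
    exists c : (n.-1).-tuple R,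
      let f := Ppoly n p.1 in
      f^`() = n%:R *: \prod_(x <- c) ('X - x%:P) /\
      uniq ([seq f.[x] | x <- c] ++ [seq f.[p.2 0 i] | i <- enum 'I_l])].

Definition components (T : topologicalType) (A : set T) : set (set T) :=
  [set connected_component A x | x in A].

(* K_n^l, with value +oo if there are infinitely many components. *)
Definition Kcomp (R : realType) (n l : nat) : \bar R :=
  counting (components (@very_nice R n l)).

(* Main.v *)
(** Sort the critical and boundary points of a very nice morsification as
    p_0 < ... < p_m. The ranks of the values f(p_i) form a permutation whose peaks
    and valleys, with respect to the limits of f at infinity, are exactly the
    critical points; together with the labels of the boundary points this is a
    locally constant invariant.

    Conversely, once the positions of the critical points among the p_i are fixed,
    the map from the gaps p_(i+1) - p_i to the differences |f(p_(i+1)) - f(p_i)| is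
    a homeomorphism of the positive orthant, so that every such invariant is
    realised by a connected set. To see this, replace the gaps by the differences
    one coordinate at a time: along the k-th coordinate line the k-th difference is
    a continuous function, locally injective by counting zeros with Rolle's
    theorem, hence injective, and it runs from 0 to infinity. Continuity of the
    inverse comes from properness.

    The number of components is therefore l! times the number of permutations with
    n-1 turns and l monotone letters. Inserting a new minimum either keeps the
    number of turns or adds two, which is the recurrence satisfied by the
    coefficients of the derivatives of u + v for D u = u v, D v = u^2, that is for
    u = sec and v = tan; at the origin these derivatives are the Bernoulli-Euler
    numbers. *)
Require Import Defs.
From mathcomp Require Import all_boot all_order all_algebra.
From mathcomp Require Import all_classical all_reals all_analysis.
From mathcomp Require Import polyrcf zify ring lra.

Set Implicit Arguments.
Unset Strict Implicit.
Unset Printing Implicit Defensive.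

Import Order.TTheory GRing.Theory Num.Theory.
Import numFieldNormedType.Exports.

Local Open Scope classical_set_scope.
Local Open Scope ring_scope.

(** * Derivatives of sec + tan *)

(* Coefficient of sec^n tan^(N+1-n) in the N-th derivative of sec + tan. *)
Fixpoint sectan_coef (N n : nat) : nat :=
  if N is N'.+1 then
    n * sectan_coef N' n +
    (if n is n'.+2 then (N - n') * sectan_coef N' n' else 0)
  else (n <= 1)%N.

Lemma sectan_coefS N n : sectan_coef N.+1 n.+2 =
  (n.+2 * sectan_coef N n.+2 + (N.+1 - n) * sectan_coef N n)%N.
Proof. by []. Qed.

Lemma sectan_coef_gt N n : (N.+1 < n)%N -> sectan_coef N n = 0%N.
Proof.
elim: N n => [|N IHN] n lt_Nn; first by rewrite /= leqNgt lt_Nn.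
case: n lt_Nn => [//|[//|n]] lt_Nn.
change ((n.+2 * sectan_coef N n.+2 + (N.+1 - n) * sectan_coef N n)%N = 0%N).
by rewrite IHN; lia.
Qed.

Definition sectan_poly (R : ringType) N (u v : R) : R :=
  \sum_(n < N.+2) (sectan_coef N n)%:R * u ^+ n * v ^+ (N.+1 - n).

(** The right-hand side is the image of [sectan_poly N u v] under the derivation D u = u v, D v =
    u^2: the first term comes from u^n, the second from v^(N+1-n). *)
Lemma sectan_polyS (R : comRingType) N (u v : R) :
  sectan_poly N.+1 u v =
  \sum_(n < N.+2) (sectan_coef N n)%:R *
     (n%:R * u ^+ n * v ^+ (N.+2 - n) +
      (N.+1 - n)%:R * u ^+ n.+2 * v ^+ (N - n)).
Proof.
rewrite /sectan_poly.
transitivity (\sum_(n < N.+3) (n * sectan_coef N n)%:R * u ^+ n * v ^+ (N.+2 - n)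
  + \sum_(n < N.+3) (if nat_of_ord n is n'.+2 then (N.+1 - n') * sectan_coef N n' else 0)%N%:R
      * u ^+ n * v ^+ (N.+2 - n)).
  by rewrite -big_split /=; apply: eq_bigr => n _; rewrite natrD !mulrDl.
under [RHS]eq_bigr do rewrite mulrDr.
rewrite big_split /=; congr (_ + _).
  rewrite big_ord_recr /= sectan_coef_gt // muln0 !mul0r addr0.
  by apply: eq_bigr => i _; rewrite natrM; ring.
rewrite [LHS]big_ord_recl [X in _ + X = _]big_ord_recl /= !mul0r !add0r.
rewrite [RHS]big_ord_recr /= subnn !mul0r mulr0 addr0.
by apply: eq_bigr => i _; rewrite natrM /bump /= !add1n !subSS; ring.
Qed.

(** * Termwise differentiation and the derivatives at the origin *)

Section PowerSeries.
Variable R : realType.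

(** The powers of q decrease, so a partial geometric sum dominates the left side. This absorbs the
    factor n+1 that differentiating a power series brings in. *)
Lemma natr_exp_bound (q : R) n : 0 <= q < 1 -> n.+1%:R * q ^+ n <= (1 - q)^-1.
Proof.
move=> /andP[q0 q1].
apply: (@le_trans _ _ (\sum_(i < n.+1) q ^+ i)).
  rewrite (_ : n.+1%:R * q ^+ n = \sum_(i < n.+1) q ^+ n); last first.
    by rewrite sumr_const card_ord mulr_natl.
  apply: ler_sum => i _.
  by apply: ler_wiXn2l => //; [exact: ltW | rewrite -ltnS].
have q1' : 0 < 1 - q by rewrite subr_gt0.
rewrite -[leRHS]div1r ler_pdivlMr // mulrC.
have -> : (1 - q) * \sum_(i < n.+1) q ^+ i = 1 - q ^+ n.+1.
  rewrite -{2}(expr1n R n.+1) subrXX; congr (_ * _); apply: eq_bigr => i _.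
  by rewrite expr1n mul1r.
by rewrite gerBl exprn_ge0.
Qed.

(** Compare at a point y strictly between [|z|] and [|x|]: the terms |c_(n+1)| y^n are summable and
    (n+1) (|z|/y)^n is bounded. *)
Lemma cvg_pseries_diffs (c : nat -> R) (x z : R) :
  cvgn (pseries c x) -> `|z| < `|x| -> cvgn (pseries (pseries_diffs c) z).
Proof.
move=> cx zx; pose y := (`|z| + `|x|) / 2.
have [zy yx] : `|z| < y /\ y < `|x| by rewrite /y !midf_lt.
have y0 : 0 < y by exact: le_lt_trans zy.
have cy : cvgn (pseries (fun i => `|c i|) y).
  by apply: is_cvg_pseries_inside_norm cx _; rewrite ger0_norm ?ltW.
have q01 : 0 <= `|z| / y < 1 by rewrite ltr_pdivrMr // mul1r zy andbT divr_ge0 // ltW.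
apply: normed_cvg.
apply: (@series_le_cvg _ _ ((1 - `|z| / y)^-1 / y *: (fun n => `|c n.+1| * y ^+ n.+1))).
- by move=> n /=.
- move=> n /=; case/andP: q01 => _ q1; have y0' := ltW y0.
  by rewrite !mulr_ge0 ?exprn_ge0 ?invr_ge0 ?subr_ge0 ?(ltW q1).
- move=> n; rewrite /pseries_diffs /= !normrM normr_nat normrX.
  rewrite [X in _ <= X](_ : _ = (1 - `|z| / y)^-1 * (`|c n.+1| * y ^+ n)); last first.
    by rewrite -[LHS]/(_ * _) exprS -mulrA [y^-1 * _]mulrCA mulKf ?gt_eqF.
  rewrite [leLHS](_ : _ = n.+1%:R * (`|z| / y) ^+ n * (`|c n.+1| * y ^+ n)).
    by rewrite ler_wpM2r ?mulr_ge0 ?exprn_ge0 ?natr_exp_bound // ltW.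
  by rewrite expr_div_n; field; rewrite expf_neq0 ?gt_eqF.
- apply: is_cvg_seriesZ.
  rewrite (_ : series _ = (fun n => series (fun i => `|c i| * y ^+ i) n.+1 - `|c 0%N|)).
    apply: is_cvgB; last exact: is_cvg_cst.
    by move/cvg_ex: cy => [l hl]; apply/cvg_ex; exists l; rewrite (cvg_shiftS (series _)).
  apply/funext => n; rewrite /series /= big_nat_recl // expr0 mulr1.
  by rewrite [RHS]addrC addKr.
Qed.

Lemma is_derive_sectan_poly N (t : R) : cos t != 0 ->
  is_derive t (1 : R) (fun t => sectan_poly N (cos t)^-1 (tan t))
    (sectan_poly N.+1 (cos t)^-1 (tan t)).
Proof.
move=> ct; pose u : R -> R := fun t => (cos t)^-1.
have du : is_derive t (1 : R) u ((cos t)^-1 * tan t).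
  apply: is_derive_eq; first exact: is_deriveV.
  by rewrite /tan /GRing.scale /= /GRing.scale /=; field.
have dv : is_derive t (1 : R) (@tan R) ((cos t)^-1 ^+ 2).
  by rewrite exprVn; exact: is_derive_tan.
rewrite (_ : (fun t0 => sectan_poly N _ _) = \sum_(n < N.+2)
    cst (sectan_coef N n)%:R * u ^+ n * (@tan R) ^+ (N.+1 - n)); last first.
  by apply/funext => x; rewrite fct_sumE; apply: eq_bigr => i _; rewrite !fctE.
rewrite sectan_polyS; apply: is_derive_sum => i.
apply: is_derive_eq; rewrite !fctE /GRing.scale /= /u.
(* This also covers i = 0, where [i.-1] is 0, because both sides carry the factor i. *)
have hi : i%:R * (cos t)^-1 ^+ i.-1 * (cos t)^-1 = i%:R * (cos t)^-1 ^+ i.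
  by case: (nat_of_ord i) => [|k]; rewrite ?mul0r // -mulrA -exprSr.
rewrite mulr0 addr0 [in RHS]mulrDr -hi subSKn [(N.+2 - i)%N]subSn; last by rewrite -ltnS.
rewrite !exprS expr0.
move: (i.-1) (N.+1 - i)%N (N - i)%N (nat_of_ord i) (tan t) (cos t)^-1 => *.
ring.
Qed.

(** Formal derivatives converge on the same open disc, so the midpoint of [|t|] and r is an outer
    point where the series and its first two formal derivatives all converge. *)
Lemma is_derive_pseries (c : nat -> R) (r t : R) :
    (forall z, `|z| < r -> cvgn (pseries c z)) -> `|t| < r ->
  is_derive t (1 : R) (fun t => limn (pseries c t))
    (limn (pseries (pseries_diffs c) t)).
Proof.
move=> cc tr.
have cd d : (forall z, `|z| < r -> cvgn (pseries d z)) ->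
    forall z, `|z| < r -> cvgn (pseries (pseries_diffs d) z).
  move=> cvd z zr; have [zy yr] := midf_lt zr.
  have y0 : 0 <= (`|z| + r) / 2 by exact: ltW (le_lt_trans _ zy).
  apply: (@cvg_pseries_diffs _ ((`|z| + r) / 2)); last by rewrite (ger0_norm y0).
  by apply: cvd; rewrite (ger0_norm y0).
have [ty yr'] := midf_lt tr.
have y0 : 0 <= (`|t| + r) / 2 by exact: ltW (le_lt_trans _ ty).
apply: (@pseries_snd_diffs _ c ((`|t| + r) / 2)).
- by apply: cc; rewrite (ger0_norm y0).
- by apply: cd cc _ _; rewrite (ger0_norm y0).
- by apply: cd (cd _ cc) _ _; rewrite (ger0_norm y0).
- by rewrite (ger0_norm y0).
Qed.

(** The N-th derivative of the expansion has constant term K N. At the origin sec is 1 and tan is 0,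
    so only the pure power of sec survives in [sectan_poly N]. *)
Lemma bernoulli_eulerE (K : nat -> R) N :
  bernoulli_euler K -> K N = (sectan_coef N N.+1)%:R.
Proof.
move=> hK; have cos0N : \forall t \near (0 : R), cos t != 0.
  have /cvgr_neq0 : cos t @[t --> (0 : R)] --> cos (0 : R) by exact: continuous_cos.
  by apply; rewrite cos0 oner_neq0.
(* The coefficients of the M-th derivative of the series. *)
pose c M m : R := K (m + M)%N / m`!%:R.
have [r /= r0 hr] : exists2 r : R, 0 < r & forall t, `|t| < r ->
    pseries (c 0%N) t @ \oo --> (cos t)^-1 + tan t /\ cos t != 0.
  have [r /= r0 hr] : nbhs (0 : R) [set t |
      pseries (fun m => K m / m`!%:R) t @ \oo --> (cos t)^-1 + tan t /\ cos t != 0].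
    by apply: filterI.
  exists r => // t tr; have := hr t; rewrite /ball /= sub0r normrN => /(_ tr).
  by rewrite (_ : (fun m => K m / m`!%:R) = c 0%N) //; apply/funext => m; rewrite /c addn0.
have cS M : pseries_diffs (c M) = c M.+1.
  apply/funext => m; rewrite /pseries_diffs /c factS natrM addnS addSn.
  by rewrite invfM mulrCA mulVKf // pnatr_eq0.
have cc M z : `|z| < r -> cvgn (pseries (c M) z).
  elim: M z => [|M IHM] z zr; first by case: (hr z zr) => /cvgP.
  have [zy yr] := midf_lt zr.
  have y0 : 0 <= (`|z| + r) / 2 by exact: ltW (le_lt_trans _ zy).
  rewrite -cS; apply: (@cvg_pseries_diffs _ ((`|z| + r) / 2)); last by rewrite (ger0_norm y0).
  by apply: IHM; rewrite (ger0_norm y0).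
(* Two functions that agree on the open disc agree near each of its points, hence so do their
   derivatives. *)
have key M t : `|t| < r -> limn (pseries (c M) t) = sectan_poly M (cos t)^-1 (tan t).
  elim: M t => [|M IHM] t tr.
    case: (hr t tr) => /cvg_lim -> // _.
    by rewrite /sectan_poly 2!big_ord_recl big_ord0 /= /bump /= !expr1 !expr0; ring.
  have d1 := is_derive_pseries (@cc M) tr.
  have d2 := is_derive_sectan_poly M (hr t tr).2.
  rewrite -cS -(@derive_val _ _ _ _ _ _ _ d1) -(@derive_val _ _ _ _ _ _ _ d2).
  apply: near_eq_derive; near=> s; apply: IHM; near: s.
  by have := @norm_continuous _ R t => /cvgr_lt; apply.
have := key N 0; rewrite normr0 => /(_ r0).
rewrite cos0 invr1 tan0 /sectan_poly big_ord_recr /= subnn expr0 expr1n !mulr1.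
rewrite big1 ?add0r => [<-|i _]; last first.
  by rewrite subSn -1?ltnS // exprS mul0r mulr0.
apply/esym/cvg_lim => //; rewrite -cvg_shiftS.
rewrite (_ : (fun n => _) = fun=> K N); first exact: cvg_cst.
apply/funext => m; rewrite /pseries /series /= big_nat_recl // big1 ?addr0.
  by rewrite /c fact0 add0n expr0; field.
by move=> i _; rewrite exprS mul0r mulr0.
Unshelve. all: by end_near. Qed.
End PowerSeries.

(** * Permutations with a given number of turns *)

Section Turns.
Local Open Scope nat_scope.

(* The entry i tells whether the word turns (peak or valley) at its letter i,
   where [e] is the direction in which the first letter is reached (from -oo if
   [e], from +oo otherwise) and the last letter is left towards +oo. *)
Definition turns (e : bool) (s : seq nat) : seq bool :=
  if s is x :: s' then pairmap addb e (rcons (pairmap ltn x s') true) else [::].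

Definition nturns e s := count id (turns e s).

(* Inserting a new minimum, the letters of [s] being positive. *)
Definition insert0 g (s : seq nat) := take g s ++ 0 :: drop g s.

Lemma insert00 s : insert0 0 s = 0 :: s.
Proof. by rewrite /insert0 take0 drop0. Qed.

Lemma size_turns e s : size (turns e s) = size s.
Proof. by case: s => //= x s; rewrite size_pairmap size_rcons size_pairmap. Qed.

Lemma nturns_cons e x y s :
  nturns e [:: x, y & s] = (e (+) (x < y)) + nturns (x < y) (y :: s).
Proof. by []. Qed.

(** The incoming direction b matters only at the first letter; T counts the turns at the other
    letters. *)
Lemma nturns_head y s :
  exists T, forall b, nturns b (y :: s) = (b (+) head true (pairmap ltn y s)) + T.
Proof.
exists (count id (pairmap addb (head true (pairmap ltn y s))
  (behead (rcons (pairmap ltn y s) true)))) => b.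
by rewrite /nturns; case: s.
Qed.

(** Form suited to induction: the minimum is inserted after x only, and c accumulates the turns
    before x. The number a counts the places that keep the number of turns. Counting the edge into
    x, taken as coming from infinity, there are T + 1 of them; that edge is one of them unless x is
    reached and left downwards. *)
Lemma sum_nturns_insert0_cons e x s c k : all (ltn 0) (x :: s) ->
  let T := nturns e (x :: s) in
  let a := T + (~~ e && ~~ head true (pairmap ltn x s)) in
  a <= (size s).+1 /\
  \sum_(g < (size s).+1) (c + nturns e (x :: insert0 g s) == k) =
    (c + T == k) * a + (c + T + 2 == k) * ((size s).+1 - a).
Proof.
elim: s e x c => [|y s IHs] e x c /andP[x0 /= s0].
  by rewrite big_ord1 /nturns /= ltnNge (ltnW x0) ; case: e; rewrite /= ?addn0; case: eqP; case: eqP; lia.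
have [le_a IH] := IHs (x < y) y (c + (e (+) (x < y))) s0.
rewrite big_ord_recl [X in _ + X = _](_ : _ =
   \sum_(g < (size s).+1)
     (c + (e (+) (x < y)) + nturns (x < y) (y :: insert0 g s) == k)); last first.
  by apply: eq_bigr => g _; rewrite /insert0 /= nturns_cons addnA.
have y0 : 0 < y by case/andP: s0.
rewrite IH (insert00 (y :: s)) !nturns_cons y0 ltn0.
have [T TE] := nturns_head y s; move: le_a; rewrite !TE {TE} => {s0 x0 y0 IH IHs}.
case: e; case: (x < y); case: (head _ _) => /=; rewrite ?addn0 ?add0n ?addn1 => le_a; split; try lia;
 do !case: eqP => /=; lia.
Qed.

(* A new minimum keeps the number of turns if the lower end of the edge that it
   cuts is a valley or -oo, which happens for [nturns e s + 1] edges, and adds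
   two turns if the lower end is a monotone letter. *)
Lemma sum_nturns_insert0 e s k : s != [::] -> all (ltn 0) s ->
  nturns e s <= size s /\
  \sum_(g < (size s).+1) (nturns e (insert0 g s) == k) =
    (nturns e s == k) * (nturns e s).+1 +
    (nturns e s + 2 == k) * (size s - nturns e s).
Proof.
case: s => // x s _ xs0; have [le_a IH] := sum_nturns_insert0_cons e 0 k xs0.
split; first by rewrite -(size_turns e) count_size.
rewrite big_ord_recl (eq_bigr _ (fun g _ => erefl _)) IH.
have x0 : 0 < x by case/andP: xs0.
rewrite (insert00 (x :: s)) nturns_cons x0.
have [T TE] := nturns_head x s; move: le_a; rewrite !TE {TE} => {xs0 x0 IH}.
by case: e; case: (head _ _) => /=; rewrite ?addn0 ?add0n ?addn1 => le_a; do !case: eqP => /=; lia.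
Qed.

Fixpoint perm_words N : seq (seq nat) :=
  if N is N'.+1 then
    [seq insert0 g (map succn s) | s <- perm_words N', g <- iota 0 N]
  else [:: [::]].

Lemma perm_wordsS N : perm_words N.+1 =
  [seq insert0 g (map succn s) | s <- perm_words N, g <- iota 0 N.+1].
Proof. by []. Qed.

Lemma perm_insert0 g s : perm_eq (insert0 g s) (0 :: s).
Proof. by rewrite /insert0 -[0 :: drop g s]cat1s perm_catCA /= cat_take_drop. Qed.

Lemma mem_perm_words N s : (s \in perm_words N) = perm_eq s (iota 0 N).
Proof.
elim: N s => [|N IHN] s; first by rewrite inE; apply/eqP/idP => [->//|/perm_nilP].
rewrite perm_wordsS; apply/allpairsP/idP => [[[w g] /= [wN gN ->]]|sN].
  rewrite (perm_trans (perm_insert0 _ _)) //= perm_cons.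
  by rewrite -add1n iotaDl [succn]/(addn 1) perm_map // -IHN.
(* Conversely, remove the letter 0 from its place g and lower the other letters by 1. *)
have s0 : 0 \in s by rewrite (perm_mem sN).
pose g := index 0 s; pose w := take g s ++ drop g.+1 s.
have sE : s = insert0 g w.
  have gs : g < size s by rewrite index_mem.
  rewrite /insert0 /w take_size_cat ?drop_size_cat ?size_take ?gs //.
  by rewrite -{1}(cat_take_drop g s) (drop_nth 0) // nth_index.
have wN : perm_eq w (map succn (iota 0 N)).
  rewrite -(perm_cons 0) -[0 :: map _ _]/(0 :: map (addn 1) _) -iotaDl.
  by rewrite -(permPl (perm_insert0 g w)) -sE.
have wE : w = map succn (map predn w).
  rewrite -map_comp -[LHS]map_id; apply/eq_in_map => x.
  by rewrite (perm_mem wN) => /mapP[y _ ->].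
exists (map predn w, g); split => /=; last by rewrite -wE.
  rewrite IHN (_ : iota 0 N = map predn (map succn (iota 0 N))); first exact: perm_map.
  by rewrite -map_comp map_id_in.
by rewrite -[(0 :: _)]/(iota 0 N.+1) mem_iota add0n -(size_iota 0 N.+1) -(perm_size sN) index_mem.
Qed.

(** The place of the letter 0 reveals g, and deleting that letter recovers the shorter word. *)
Lemma perm_words_uniq N : uniq (perm_words N).
Proof.
elim: N => // N IHN; rewrite perm_wordsS; apply: allpairs_uniq => //; first exact: iota_uniq.
move=> sg th Hsg Hth; case/allpairsP: Hsg => [[s' g'] /= [sN gN ->]].
case/allpairsP: Hth => [[t' h'] /= [tN hN ->]].
rewrite -[0 :: iota 1 N]/(iota 0 N.+1) in gN hN.
have idx u k : u \in perm_words N -> k \in iota 0 N.+1 ->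
    index 0 (insert0 k (map succn u)) = k.
  rewrite mem_perm_words mem_iota add0n ltnS /= => uN kN.
  have uk : k <= size (map succn u) by rewrite size_map (perm_size uN) size_iota.
  rewrite /insert0 index_cat size_takel // /= addn0 ifN //.
  by apply/negP => /mem_take /mapP[].
move=> E; have gh : g' = h' by rewrite -(idx s' g') // -(idx t' h') // E.
rewrite gh in E *; congr (_, _); apply: (inj_map succn_inj).
move: E; rewrite /insert0 => /eqP; rewrite eqseq_cat; last first.
  have sz u : u \in perm_words N -> size (take h' (map succn u)) = h'.
    rewrite mem_perm_words => uN; rewrite size_takel // size_map (perm_size uN) size_iota.
    by move: hN; rewrite mem_iota add0n ltnS.
  by rewrite !sz.
move=> /andP[/eqP E1 /eqP[E2]].
by rewrite -(cat_take_drop h' (map succn s')) E1 E2 cat_take_drop.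
Qed.

Definition num_turns e N k := count (fun s => nturns e s == k) (perm_words N).

(** Words with k turns come from words with k turns, in k+1 ways each, or from words with k-2 turns,
    at the remaining places. *)
Lemma num_turnsS e N k : num_turns e N.+2 k =
  k.+1 * num_turns e N.+1 k +
  (if k is k'.+2 then (N.+1 - k') * num_turns e N.+1 k' else 0).
Proof.
have turnsS s : nturns e (map succn s) = nturns e s.
  case: s => // x s; rewrite /nturns /turns; congr (count _ (pairmap _ _ (rcons _ _))).
  by elim: s x => //= y s IHs x; rewrite IHs.
rewrite /num_turns; set W := perm_words N.+1.
rewrite perm_wordsS -/W.
rewrite count_flatten -map_comp sumnE big_map.
transitivity (\sum_(s <- W) ((nturns e s == k) * (nturns e s).+1 +
   (nturns e s + 2 == k) * (N.+1 - nturns e s))).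
  rewrite !big_seq; apply: eq_bigr => s sW.
  have szs : size s = N.+1 by move: sW; rewrite mem_perm_words => /perm_size ->; rewrite size_iota.
  have [||_] := @sum_nturns_insert0 e (map succn s) k.
  - by case: (s) szs.
  - by apply/allP => z /mapP[y _ ->].
  rewrite turnsS size_map szs => <-; rewrite [LHS]count_map -sum1_count big_mkcond.
  by rewrite -[iota 0 _]/(index_iota 0 N.+2) big_mkord; apply: eq_bigr.
rewrite big_split /= -!sum1_count [in RHS]big_distrr /=; congr (_ + _).
  by rewrite [RHS]big_mkcond /=; apply: eq_bigr => s _; case: eqP => [->|_]; rewrite ?muln1 ?mul1n.
case: k => [|[|k]]; first by rewrite big1 // => s _; rewrite addn2.
  by rewrite big1 // => s _; rewrite addn2 eqSS.
rewrite -sum1_count big_distrr /= [RHS]big_mkcond /=; apply: eq_bigr => s _.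
by rewrite addn2 !eqSS; case: eqP => [->|_]; rewrite ?muln1 ?mul1n.
Qed.

(** Both sides obey the same recurrence, with k + 1 = n. It lowers n by 0 or 2, so the initial
    direction [odd n] stays fixed along it. *)
Lemma num_turns_sectan N n : 0 < n ->
  num_turns (odd n) N.+1 n.-1 = sectan_coef N.+1 n.
Proof.
elim: N n => [|N IHN] n n0.
  case: n n0 => [//|[|[|[|n]]]] _ //=; rewrite /num_turns /nturns /= ?negbK. by case: (odd n); rewrite ?muln0.
(* For n = 2 the coefficient of index 0 enters the recurrence; it has no counterpart among the words
   and must vanish. *)
have e0 : sectan_coef N.+1 0 = 0 by elim: (N).
rewrite num_turnsS prednK // IHN //.
rewrite -[RHS]/(n * sectan_coef N.+1 n +
  (if n is n'.+2 then (N.+2 - n') * sectan_coef N.+1 n' else 0)).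
case: n n0 => [//|[//|[|n]]] _; first by rewrite e0 muln0.
by rewrite -(IHN n.+1) // subSS !oddS negbK.
Qed.

Definition turn_tuples N e k : {set N.-tuple 'I_N} :=
  [set w : N.-tuple 'I_N | uniq w && (nturns e (map val w) == k)].

Lemma card_turn_tuples N e k : #|turn_tuples N e k| = num_turns e N k.
Proof.
rewrite /num_turns -size_filter cardE -(size_map (fun w : N.-tuple 'I_N => map val w)).
apply: perm_size; apply: uniq_perm.
- rewrite map_inj_uniq ?enum_uniq // => u v /inj_map uv.
  by apply/val_inj/uv/val_inj.
- by rewrite filter_uniq ?perm_words_uniq.
move=> s; rewrite mem_filter mem_perm_words; apply/mapP/andP => [[w]|[sk sN]].
  rewrite mem_enum inE => /andP[uw wk] ->; split => //.
  rewrite -val_enum_ord; apply/perm_map/uniq_perm; rewrite ?enum_uniq // => i.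
  rewrite mem_enum; suff -> : w =i 'I_N by [].
  by apply/subset_cardP; rewrite ?subset_predT // (card_uniqP uw) size_tuple card_ord.
pose t := pmap (insub : nat -> option 'I_N) s.
have tE : map val t = s.
  rewrite /t (pmap_filter (insubK _)); apply/all_filterP/allP => i.
  by rewrite (perm_mem sN) mem_iota add0n => iN; rewrite /= insubT.
have st : size t == N by rewrite -(size_map val) tE (perm_size sN) size_iota.
exists (Tuple st); last by rewrite /= tE.
by rewrite mem_enum inE /= tE sk andbT -(map_inj_uniq val_inj) tE (perm_uniq sN) iota_uniq.
Qed.
End Turns.

(** * Polynomials with marked critical points *)

Section CritPoly.
Variable R : rcfType.
Implicit Types (a : nat -> bool) (p q : nat -> R) (F G h : {poly R}).

(* [a] marks the indices of the critical points. *)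
Definition nmark a i j := (\sum_(i <= k < j | a k) 1)%N.

Definition crit a i j p : {poly R} := \prod_(i <= k < j | a k) ('X - (p k)%:P).

Lemma monic_crit a i j p : crit a i j p \is monic.
Proof. exact: monic_prod_XsubC. Qed.

Lemma size_crit a i j p : size (crit a i j p) = (nmark a i j).+1.
Proof. by rewrite /crit -big_filter size_prod_XsubC -sum1_size /nmark big_filter. Qed.

Lemma crit_cat a i k j p : (i <= k <= j)%N ->
  crit a i j p = crit a i k p * crit a k j p.
Proof. by move=> /andP[? ?]; exact: big_cat_nat. Qed.

Lemma eq_crit a b i j p q : (forall k, (i <= k < j)%N -> a k = b k) ->
  (forall k, (i <= k < j)%N -> p k = q k) -> crit a i j p = crit b i j q.
Proof.
move=> ab pq; rewrite /crit big_nat_cond [RHS]big_nat_cond.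
apply: eq_big => k; first by apply: andb_id2l => /ab.
by move=> /andP[/pq ->].
Qed.

Lemma nmark_ltn a i j : (i < j)%N -> nmark a i j = (a i + nmark a i.+1 j)%N.
Proof. by move=> ij; rewrite /nmark big_ltn_cond //; case: (a i). Qed.

Lemma horner_crit a i j p x :
  (crit a i j p).[x] = \prod_(i <= k < j | a k) (x - p k).
Proof. by rewrite horner_prod; apply: eq_bigr => k _; rewrite hornerXsubC. Qed.

Lemma root_crit a i j p x :
  reflect (exists k, [/\ (i <= k < j)%N, a k & x = p k]) (root (crit a i j p) x).
Proof.
rewrite /root horner_crit prodf_seq_eq0; apply: (iffP hasP) => [[k]|[k [kij ak ->]]].
  by rewrite mem_index_iota subr_eq0 => kij /andP[ak /eqP ->]; exists k.
by exists k; rewrite ?mem_index_iota ?kij // ak subrr eqxx.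
Qed.

(** The negative factors are those of the marked points to the right of x, which have index at least
    j. *)
Lemma crit_sign a j m p x : (j <= m)%N ->
    (forall i, (i < j)%N -> p i < x) -> (forall i, (j <= i < m)%N -> x < p i) ->
  (-1) ^+ nmark a j m * (crit a 0 m p).[x] = \prod_(0 <= i < m | a i) `|x - p i|.
Proof.
move=> jm lo hi; rewrite horner_crit [in LHS](big_cat_nat (leq0n j) jm) [RHS](big_cat_nat (leq0n j) jm) /= mulrCA; congr (_ * _).
  by rewrite big_nat_cond [RHS]big_nat_cond; apply: eq_bigr => i /andP[/andP[_ ij] _]; rewrite gtr0_norm // subr_gt0 lo.
rewrite /nmark -prodrXr -big_split /= big_nat_cond [RHS]big_nat_cond; apply: eq_bigr => i /andP[ij _].
by rewrite expr1 mulN1r ltr0_norm // subr_lt0 hi.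
Qed.

Lemma crit_sign_gt0 a j m p x : (j <= m)%N ->
    (forall i, (i < j)%N -> p i < x) -> (forall i, (j <= i < m)%N -> x < p i) ->
  0 < (-1) ^+ nmark a j m * (crit a 0 m p).[x].
Proof.
move=> jm lo hi; rewrite crit_sign // big_nat_cond prodr_gt0 // => i /andP[im _].
rewrite normr_gt0 subr_eq0; case: (ltnP i j) => ij; first by rewrite gt_eqF // lo.
by rewrite lt_eqF // hi // ij; case/andP: im.
Qed.

Lemma deriv0_horner h x y : h^`() = 0 -> h.[x] = h.[y].
Proof.
move=> h0; wlog xy : x y / x < y => [H|].
  by case: (ltgtP x y) => [/H|/H|->].
have [c _] := poly_mvt h xy; rewrite h0 horner0 mul0r => /eqP.
by rewrite subr_eq0 => /eqP.
Qed.

(** The bound by the last zero of h later separates the zeros of the derivative from the marked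
    points at or beyond that zero. *)
Lemma rolle_seq h x s : path <%R x s -> all (root h) (x :: s) ->
  exists t, [/\ size t = size s, path <%R x t, all (root h^`()) t &
               all (fun y => y < last x s) t].
Proof.
elim/last_ind: s => [|s y IHs]; first by exists [::].
rewrite rcons_path -rcons_cons all_rcons => /andP[xs lt_y] /andP[ry rs].
have [t [st xt rt lt]] := IHs xs rs.
have hE : h.[last x s] = h.[y].
  have /rootP -> : root h (last x s) by move/allP: rs; apply; exact: mem_last.
  by rewrite (rootP ry).
have [c] := poly_rolle lt_y hE; rewrite in_itv /= => /andP[sc cy] hc.
exists (rcons t c); rewrite !size_rcons st rcons_path xt all_rcons rt last_rcons all_rcons cy /=.
split => //.
- have := mem_last x t; rewrite inE => /orP[/eqP ->|]; last first.
    by move/(allP lt) => /lt_trans ->.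
  have : x <= last x s; last by move/le_lt_trans; apply.
  have := mem_last x s; rewrite inE => /orP[/eqP ->//|].
  by move: xs; rewrite lt_path_sortedE => /andP[/allP xs _] /xs /ltW.
- by rewrite andbT; apply/rootP.
- by apply: sub_all lt => z /lt_trans; apply; exact: lt_trans cy.
Qed.

(** By the mean value theorem, F - G has at p i the sign of G' on the left of q i, and at q i the
    sign of F' on the right of p i. The interlacing keeps points of other index out of the interval,
    so these signs differ exactly by the marked index i, and the intermediate value theorem
    applies. *)
Lemma crit_hull_root a m p q F G (c : R) i :
    0 < c -> F^`() = c *: crit a 0 m p -> G^`() = c *: crit a 0 m q ->
    (forall i j, (i < j < m)%N -> [/\ p i < p j, q i < q j, p i < q j & q i < p j]) ->
    (i < m)%N -> a i -> F.[p i] = G.[q i] -> p i <= q i ->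
  exists2 z, p i <= z <= q i & root (F - G) z.
Proof.
move=> c0 F' G' pq im ai FG; rewrite le_eqVlt => /predU1P[piqi|lt_pq].
  exists (p i); first by rewrite -piqi lexx.
  by rewrite /root hornerD hornerN FG -piqi subrr.
have [x] := poly_mvt F lt_pq; rewrite in_itv /= => /andP[px xq] Fx.
have [y] := poly_mvt G lt_pq; rewrite in_itv /= => /andP[py yq] Gy.
have sx : 0 < (-1) ^+ nmark a i.+1 m * (crit a 0 m p).[x].
  apply: crit_sign_gt0 => // k; rewrite ?ltnS => ki.
    move: ki; rewrite leq_eqVlt => /predU1P[->//|ki].
    have kim : (k < i < m)%N by rewrite ki.
    by have [h _ _ _] := pq _ _ kim; exact: lt_trans px.
  by have [_ _ _ h] := pq _ _ ki; exact: lt_trans h.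
have sy : 0 < (-1) ^+ nmark a i m * (crit a 0 m q).[y].
  apply: crit_sign_gt0 => // [|k ki|k /andP[ki km]]; first exact: ltnW.
    have kim : (k < i < m)%N by rewrite ki.
    by have [_ _ _ h] := pq _ _ kim; exact: lt_trans py.
  move: ki; rewrite leq_eqVlt => /predU1P[<-//|ki].
  have ikm : (i < k < m)%N by rewrite ki.
  by have [_ h _ _] := pq _ _ ikm; exact: lt_trans h.
have nE : nmark a i m = (nmark a i.+1 m).+1.
  by rewrite nmark_ltn // ai.
have [||z zpq rz] := @polyrcf.poly_ivt _ (F - G) (p i) (q i); first exact: ltW.
  have -> : (F - G).[p i] = G^`().[y] * (q i - p i) by rewrite hornerD hornerN FG Gy.
  have -> : (F - G).[q i] = F^`().[x] * (q i - p i) by rewrite hornerD hornerN -FG Fx.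
  rewrite F' G' !hornerZ mulrACA; apply: mulr_le0_ge0; last by rewrite -expr2 sqr_ge0.
  rewrite mulrACA pmulr_rle0; last exact: mulr_gt0.
  move: sx sy.
  rewrite -signr_odd -[_ ^+ nmark a i m]signr_odd nE oddS.
  case: (odd _); rewrite /= ?expr0 ?expr1 ?mul1r ?mulN1r ?oppr_gt0 => u v.
    by apply: mulr_ge0_le0; exact: ltW.
  by apply: mulr_le0_ge0; exact: ltW.
by exists z => //; move: zpq; rewrite in_itv.
Qed.

(* Normalise F and G to agree at the point k+1. At a marked i <= k the two
   polynomials take the same extremal value at p i and at q i, so F - G vanishes
   between p i and q i; it also vanishes at the point k+1. By Rolle its
   derivative, which is a constant times (A - B) R with A, B monic of degree the
   number of marked i <= k, has too many zeros for A - B to be nonzero. *)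
Lemma crit_local_inj a m p q F G (c : R) k :
    0 < c -> F^`() = c *: crit a 0 m.+1 p -> G^`() = c *: crit a 0 m.+1 q ->
    (forall i j, (i < j <= m)%N -> [/\ p i < p j, q i < q j, p i < q j & q i < p j]) ->
    (k < m)%N -> (forall i, (k < i <= m)%N -> p i = q i) ->
    (forall i, (i <= k)%N -> F.[p i.+1] - F.[p i] = G.[q i.+1] - G.[q i]) ->
  forall i, (i <= m)%N -> p i = q i.
Proof.
move=> c0 F' G'0 pq km pqk FG0; pose d := F.[p k.+1] - G.[q k.+1].
have [H [G' FG FGk]] : exists H : {poly R}, [/\ H^`() = c *: crit a 0 m.+1 q,
    forall i, (i <= k)%N -> F.[p i.+1] - F.[p i] = H.[q i.+1] - H.[q i] &
    F.[p k.+1] = H.[q k.+1]].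
  exists (G + d%:P); split.
  - by rewrite derivD derivC addr0.
  - by move=> i ik; rewrite FG0 // !hornerD !hornerC; ring.
  - by rewrite hornerD hornerC /d; ring.
move: H G' FG FGk => {G'0 FG0 d} {}G G' FG FGk.
have pk : p k.+1 = q k.+1 by apply: pqk; rewrite ltnSn.
have {FGk}{}FG i : (i <= k.+1)%N -> F.[p i] = G.[q i].
  move=> ik; rewrite -(subKn ik); elim: (k.+1 - i)%N (leq_subr i k.+1) => [|r IHr] rk.
    by rewrite subn0.
  have := FG (k.+1 - r.+1)%N; rewrite subSS leq_subr -subSn // => /(_ isT).
  by rewrite IHr ?(ltnW rk) // => /addrI /oppr_inj.
have hz i : (i <= k)%N -> a i ->
    exists z, [/\ Num.min (p i) (q i) <= z, z <= Num.max (p i) (q i) & root (F - G) z].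
  move=> ik ai; have im : (i < m.+1)%N by exact: leq_ltn_trans ik (ltnW _).
  case: (leP (p i) (q i)) => piq.
    have [z /andP[]] := @crit_hull_root a m.+1 p q F G c i c0 F' G' pq im ai (FG i (leqW ik)) piq.
    by exists z.
  have qp i' j' : (i' < j' < m.+1)%N -> [/\ q i' < q j', p i' < p j', q i' < p j' & p i' < q j'].
    by move=> /pq[].
  have [z /andP[pz zq] rz] := @crit_hull_root a m.+1 q p G F c i c0 G' F' qp im ai (esym (FG i (leqW ik))) (ltW piq).
  by exists z; split=> //; rewrite -opprB rootN.
have [zz hzz] : exists zz : nat -> R, forall i, (i <= k)%N -> a i ->
    [/\ Num.min (p i) (q i) <= zz i, zz i <= Num.max (p i) (q i) & root (F - G) (zz i)].
  have /choice[zz hzz] : forall i, exists z, (i <= k)%N -> a i ->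
      [/\ Num.min (p i) (q i) <= z, z <= Num.max (p i) (q i) & root (F - G) z].
    move=> i; case ik : (i <= k)%N; last by exists 0.
    by case ai : (a i); [have [z hz'] := hz i ik ai; exists z | exists 0].
  by exists zz.
(* The zeros of F - G: one per marked index up to k, and the common point of index k+1. By
   interlacing they increase with the index. *)
pose I := [seq i <- iota 0 k.+1 | a i]; pose z i := if i == k.+1 then p k.+1 else zz i.
have Ik i : i \in I -> (i <= k)%N /\ a i by rewrite mem_filter mem_iota add0n ltnS => /andP[].
have zI i : i \in I -> z i = zz i by move=> /Ik[ik _]; rewrite /z ltn_eqF.
pose s := rcons (map z I) (p k.+1).
have rs : all (root (F - G)) s.
  rewrite all_rcons; apply/andP; split.
    by rewrite /root hornerD hornerN FG // pk subrr.
  apply/allP => x /mapP[i iI ->]; rewrite zI //.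
  by have [ik ai] := Ik i iI; have [] := hzz i ik ai.
have ss : sorted <%R s.
  rewrite (_ : s = map z (rcons I k.+1)); last by rewrite map_rcons /s /z eqxx.
  apply: (@homo_sorted_in _ _ (mem (rcons I k.+1)) z ltn); last 2 first.
  - exact/allP.
  - apply: (subseq_sorted ltn_trans _ (iota_ltn_sorted 0 k.+2)).
    by rewrite -[k.+2]addn1 iotaD -cats1 cat_subseq // filter_subseq.
  have zB i : i \in rcons I k.+1 -> [/\ (i <= k.+1)%N,
      Num.min (p i) (q i) <= z i & z i <= Num.max (p i) (q i)].
    rewrite mem_rcons inE => /predU1P[->|iI].
      by rewrite /z eqxx -pk minxx maxxx.
    by rewrite zI //; have [ik ai] := Ik i iI; have [? ? _] := hzz i ik ai; rewrite leqW.
  move=> i j /zB[_ _ zi] /zB[jk zj _] ij; apply: (le_lt_trans zi); apply: (lt_le_trans _ zj).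
  have ijm : (i < j <= m)%N by rewrite [(i < j)%N]ij (leq_trans jk).
  by have [? ? ? ?] := pq _ _ ijm; rewrite gt_max !lt_min; apply/andP; split; apply/andP.
pose A := crit a 0 k.+1 p; pose B := crit a 0 k.+1 q.
have kk : (0 <= k.+1 <= m.+1)%N by rewrite /= ltnS ltnW.
have RE : crit a k.+1 m.+1 q = crit a k.+1 m.+1 p.
  by apply: eq_crit => // i /andP[ki im]; rewrite pqk ?ki.
(* The leading terms of A and B cancel, so A - B has degree below the number of zeros that Rolle's
   theorem gives. These zeros lie left of p (k+1), hence are not zeros of the common factor. *)
have AB : A = B.
  have sN : size s = (nmark a 0 k.+1).+1.
    by rewrite size_rcons size_map /I -sum1_size big_filter.
  case sE : s sN => [//|x s'] [sN].
  have [t [st xt rt lt]] : exists t, [/\ size t = size s', path <%R x t,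
      all (root (F - G)^`()) t & all (fun y => y < last x s') t].
    by apply: rolle_seq; [move: ss | move: rs]; rewrite sE.
  have lE : last x s' = p k.+1 by rewrite -[last x s']/(last x (x :: s')) -sE last_rcons.
  apply/eqP; rewrite -subr_eq0; apply/eqP; apply: (@poly_ltsp_roots _ _ t).
  - rewrite st sN; apply/leq_sizeP => j; rewrite coefB leq_eqVlt => /predU1P[<-|jN].
      have lA := monicP (monic_crit a 0 k.+1 p); have lB := monicP (monic_crit a 0 k.+1 q).
      by move: lA lB; rewrite /lead_coef !size_crit /= -/A -/B => -> ->; rewrite subrr.
    by rewrite !nth_default ?subrr // size_crit.
  - by move: xt => /path_sorted; exact: lt_sorted_uniq.
  - apply/allP => y yt; have := allP rt y yt.
    rewrite derivB F' G' (@crit_cat a 0 k.+1 m.+1 p) // (@crit_cat a 0 k.+1 m.+1 q) // RE.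
    rewrite -scalerBr -mulrBl rootZ ?gt_eqF // rootM => /orP[//|/root_crit[j [/andP[kj jm] _ yE]]].
    have := allP lt y yt; rewrite lE yE.
    move: kj; rewrite leq_eqVlt => /predU1P[<-|kj]; first by rewrite ltxx.
    have kjm : (k.+1 < j <= m)%N by rewrite kj.
    by have [/ltW/le_gtF ->] := pq _ _ kjm.
have F'G' : F^`() = G^`().
  by rewrite F' G' (@crit_cat a 0 k.+1 m.+1 p) // (@crit_cat a 0 k.+1 m.+1 q) // RE -/A AB.
have FGE x : F.[x] = G.[x].
  have := @deriv0_horner (F - G) x (p k.+1); rewrite derivB F'G' subrr => /(_ erefl).
  rewrite !hornerD !hornerN FG // -pk subrr => /eqP.
  by rewrite subr_eq0 => /eqP.
move=> i im; case: (ltnP k i) => ki; first by apply: pqk; rewrite ki.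
(* A marked p i is a root of B, thus some q j; interlacing forces j = i. *)
case ai : (a i).
  have : root B (p i) by rewrite -AB; apply/root_crit; exists i; rewrite ltnS ki ai.
  move=> /root_crit[j [/andP[_ jk] aj pE]]; rewrite ltnS in jk.
  have jm : (j <= m)%N := leq_trans jk (ltnW km).
  case: (ltngtP i j) => [ij|ji|->] in pE *; last by [].
    have ijm : (i < j <= m)%N by rewrite ij.
    by have [_ _ + _] := pq _ _ ijm; rewrite pE ltxx.
  have jim : (j < i <= m)%N by rewrite ji.
  by have [_ _ _] := pq _ _ jim; rewrite pE ltxx.
(* For an unmarked i, F = G takes one value at p i and q i. If these were distinct, Rolle's theorem
   would place a critical point between them, where interlacing allows none. *)
have noroot p' q' x : (forall i j, (i < j <= m)%N -> [/\ p' i < p' j, q' i < q' j, p' i < q' j & q' i < p' j]) ->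
    p' i < x < q' i -> ~~ root (crit a 0 m.+1 p') x.
  move=> pq' /andP[px xq]; apply/negP => /root_crit[j [/andP[_ jm] aj xE]]; rewrite ltnS in jm.
  case: (ltngtP i j) aj => [ij _|ji _|<-]; last by rewrite ai.
    have ijm : (i < j <= m)%N by rewrite ij.
    by have [_ _ _ /(lt_trans xq)] := pq' _ _ ijm; rewrite xE ltxx.
  have jim : (j < i <= m)%N by rewrite ji.
  by have [/lt_trans/(_ px)] := pq' _ _ jim; rewrite xE ltxx.
case: (ltgtP (p i) (q i)) => [lt_pq|lt_qp|//].
  have FE : F.[p i] = F.[q i] by rewrite [RHS]FGE FG ?leqW.
  have [x] := poly_rolle lt_pq FE; rewrite in_itv /= F' hornerZ => /(noroot _ _ _ pq) /negP nr.
  by move/eqP; rewrite mulf_eq0 gt_eqF //= => /nr.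
have qp i' j' : (i' < j' <= m)%N -> [/\ q i' < q j', p i' < p j', q i' < p j' & p i' < q j'].
  by move=> /pq[].
have GE : G.[q i] = G.[p i] by rewrite -FG ?leqW // FGE.
have [x] := poly_rolle lt_qp GE; rewrite in_itv /= G' hornerZ => /(noroot _ _ _ qp) /negP nr.
by move/eqP; rewrite mulf_eq0 gt_eqF //= => /nr.
Qed.

End CritPoly.

(** * Primitives and bounds for differences of values *)

Section Bounds.
Variable R : rcfType.
Implicit Types (a : nat -> bool) (p q : nat -> R) (F G h : {poly R}).

(** At i = 0 division by zero yields 0, so this is the primitive without constant term. *)
Definition prim F : {poly R} := \poly_(i < (size F).+1) (F`_i.-1 / i%:R).

Lemma coef_prim F i : (prim F)`_i = F`_i.-1 / i%:R.
Proof.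
by rewrite coef_poly; case: ltnP => // hi; rewrite nth_default ?mul0r // -ltnS (ltn_predK hi).
Qed.

Lemma deriv_prim F : (prim F)^`() = F.
Proof.
apply/polyP => i; rewrite coef_deriv coef_poly /= ltnS.
case: ltnP => iF; last by rewrite mul0rn nth_default.
by rewrite -[LHS]mulr_natr divfK ?pnatr_eq0.
Qed.

Lemma ler_prod_nmark a i j (f g : nat -> R) :
    (forall k, (i <= k < j)%N -> a k -> 0 <= f k <= g k) ->
  \prod_(i <= k < j | a k) f k <= \prod_(i <= k < j | a k) g k.
Proof.
move=> fg; rewrite big_nat_cond [leRHS]big_nat_cond; apply: ler_prod => k /andP[].
exact: fg.
Qed.

Lemma prod_const_nmark a i j (c : R) : \prod_(i <= k < j | a k) c = c ^+ nmark a i j.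
Proof. by rewrite /nmark -prodrXr; apply: eq_bigr. Qed.

(** The sign makes the polynomial increase between the two points. Above, the mean value theorem
    bounds each factor of the derivative by the total length. Below, it suffices to look at the
    middle third of the interval, which has distance at least a third of the gap from every
    point. *)
Lemma crit_diff_bounds a m p F (c : R) j :
    0 < c -> F^`() = c *: crit a 0 m.+1 p ->
    (forall i k, (i < k <= m)%N -> p i < p k) -> (j < m)%N ->
  c * ((p j.+1 - p j) / 3) ^+ (nmark a 0 m.+1).+1 <=
    (-1) ^+ nmark a j.+1 m.+1 * (F.[p j.+1] - F.[p j]) <=
    c * (p m - p 0%N) ^+ nmark a 0 m.+1 * (p j.+1 - p j).
Proof.
move=> c0 F' pp jm; set d := p j.+1 - p j; set t := nmark a 0 m.+1; set s := (-1) ^+ _; pose G := s *: F.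
have d0 : 0 < d by rewrite subr_gt0 pp // ltnSn.
pose P x := \prod_(0 <= i < m.+1 | a i) `|x - p i|.
have ple i k : (i <= k <= m)%N -> p i <= p k.
  by rewrite leq_eqVlt => /andP[/predU1P[->//|ik] km]; rewrite ltW // pp ?ik.
have lo x i : p j < x -> (i < j.+1)%N -> p i <= p j.
  by move=> _ ij; apply: ple; rewrite -ltnS ij ltnW.
have hi i : (j.+1 <= i < m.+1)%N -> p j.+1 <= p i.
  by move=> /andP[ji im]; apply: ple; rewrite ji -ltnS.
have G' x : p j < x < p j.+1 -> G^`().[x] = c * P x.
  move=> /andP[px xp]; rewrite derivZ F' !hornerZ mulrCA crit_sign //.
  - exact: ltnW.
  - by move=> i /(lo x i px) h; exact: le_lt_trans px.
  - by move=> i /hi; exact: lt_le_trans.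
have P0 x : 0 <= P x by apply: prodr_ge0.
have mvt u v : p j <= u -> u < v -> v <= p j.+1 ->
    exists x, u < x < v /\ G.[v] - G.[u] = c * P x * (v - u).
  move=> pu uv vp; have [x] := poly_mvt G uv; rewrite in_itv /= => xuv E; exists x; split=> //.
  by rewrite E G' //; case/andP: xuv => ux xv; rewrite (le_lt_trans pu) //= (lt_le_trans xv).
have -> : s * (F.[p j.+1] - F.[p j]) = G.[p j.+1] - G.[p j] by rewrite !hornerZ mulrBr.
apply/andP; split; last first.
  have pj : p j < p j.+1 by rewrite -subr_gt0.
  have [x [/andP[px xp] ->]] := mvt (p j) (p j.+1) (lexx _) pj (lexx _).
  rewrite ler_wpM2r ?(ltW d0) // ler_wpM2l ?(ltW c0) // -prod_const_nmark.
  apply: ler_prod_nmark => k /andP[_ km] _; rewrite normr_ge0 /=.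
  have : p 0%N <= p k by apply: ple; rewrite leq0n.
  have : p k <= p m by apply: ple; rewrite -ltnS km leqnn.
  have : p j.+1 <= p m by apply: ple; rewrite jm leqnn.
  have : p 0%N <= p j by apply: ple; rewrite leq0n ltnW.
  by move=> *; rewrite ler_norml; apply/andP; split; lra.
pose u := p j + d / 3; pose v := p j + d / 3 + d / 3.
have pu : p j < u by rewrite /u; lra.
have uv : u < v by rewrite /v /u; lra.
have vp : v < p j.+1 by rewrite /v; move: d0; rewrite /d; lra.
have [x [xuv E]] := mvt u v (ltW pu) uv (ltW vp).
have [x1 [_ E1]] := mvt (p j) u (lexx _) pu (ltW (lt_trans uv vp)).
have [x2 [_ E2]] := mvt v (p j.+1) (ltW (lt_trans pu uv)) vp (lexx _).
have -> : G.[p j.+1] - G.[p j] = (G.[p j.+1] - G.[v]) + (G.[v] - G.[u]) + (G.[u] - G.[p j]).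
  by ring.
rewrite E E1 E2 -addrA ler_wpDl //.
  by rewrite !mulr_ge0 ?(ltW c0) // subr_ge0 ltW.
rewrite ler_wpDr //.
  by rewrite !mulr_ge0 ?(ltW c0) // subr_ge0 ltW.
have -> : v - u = d / 3 by rewrite /v /u; ring.
rewrite exprSr mulrA ler_wpM2r //; first by rewrite divr_ge0 // ltW.
rewrite ler_wpM2l ?(ltW c0) // -prod_const_nmark; apply: ler_prod_nmark => k /andP[_ km] _.
rewrite divr_ge0 ?(ltW d0) //=; move: xuv; rewrite /u /v => /andP[ux xv].
case: (ltnP k j.+1) => kj.
  have := lo x k _ kj; rewrite (le_lt_trans _ ux); last by lra.
  by move=> /(_ isT) pk; rewrite ler_normr; apply/orP; left; lra.
have := hi k; rewrite kj km => /(_ isT) pk.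
by rewrite ler_normr; apply/orP; right; move: pk ux xv; rewrite /d; lra.
Qed.

End Bounds.

(** * The gap-to-difference homeomorphism *)

Section PolyCvg.
Variable (R : realType).

Lemma cvg_sum_ord (T : Type) (F : set_system T) {FF : Filter F} n
    (f : 'I_n -> T -> R) (l : 'I_n -> R) (P : pred 'I_n) :
  (forall i, P i -> f i t @[t --> F] --> l i) ->
  \sum_(i < n | P i) f i t @[t --> F] --> \sum_(i < n | P i) l i.
Proof.
move=> fl; apply: (cvg_big (op := +%R)) => // i j; exact: add_continuous.
Qed.

(** Coefficientwise convergence with a common degree bound, so that evaluation is a sum of a fixed
    number of terms. *)
Definition poly_cvg (T : Type) (F : set_system T) (f : T -> {poly R}) (q : {poly R}) :=
  (exists d, (forall t, (size (f t) <= d)%N) /\ (size q <= d)%N) /\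
  forall i, (f t)`_i @[t --> F] --> q`_i.

Context (T : Type) (F : set_system T) {FF : Filter F}.
Implicit Types (f g : T -> {poly R}) (q r : {poly R}).

Lemma poly_cvg_cst q : poly_cvg F (fun=> q) q.
Proof. by split; [exists (size q) | move=> i; exact: cvg_cst]. Qed.

Lemma poly_cvgM f g q r : poly_cvg F f q -> poly_cvg F g r ->
  poly_cvg F (fun t => f t * g t) (q * r).
Proof.
move=> [[d [fd qd]] fq] [[e [ge re]] gr]; split.
  exists (d + e)%N; split => [t|]; apply: (leq_trans (size_polyMleq _ _));
    apply: (leq_trans (leq_pred _)); exact: leq_add.
move=> i; rewrite coefM; under eq_fun do rewrite coefM.
by apply: cvg_sum_ord => j _; apply: cvgM.
Qed.

Lemma poly_cvgZ (c : R) f q : poly_cvg F f q -> poly_cvg F (fun t => c *: f t) (c *: q).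
Proof.
move=> [[d [fd qd]] fq]; split.
  by exists d; split => [t|]; apply: (leq_trans (size_scale_leq _ _)).
by move=> i; rewrite coefZ; under eq_fun do rewrite coefZ; apply: cvgM => //; exact: cvg_cst.
Qed.

Lemma poly_cvgXsubC (g : T -> R) (l : R) : g @ F --> l ->
  poly_cvg F (fun t => 'X - (g t)%:P) ('X - l%:P).
Proof.
move=> gl; split; first by exists 2%N; split => [t|]; rewrite size_XsubC.
move=> i; rewrite coefB coefX coefC; under eq_fun do rewrite coefB coefX coefC.
by apply: cvgB; [exact: cvg_cst | case: ifP => // _; exact: cvg_cst].
Qed.

Lemma poly_cvg_crit a i j (p : T -> nat -> R) (l : nat -> R) :
  (forall k, (i <= k < j)%N -> p t k @[t --> F] --> l k) ->
  poly_cvg F (fun t => crit a i j (p t)) (crit a i j l).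
Proof.
rewrite /crit; elim: j => [|j IHj] pl.
  by rewrite big_geq //; under eq_fun do rewrite big_geq //; exact: poly_cvg_cst.
case: (leqP i j) => ij; last first.
  by rewrite big_geq //; under eq_fun do rewrite big_geq //; exact: poly_cvg_cst.
rewrite big_mkcond big_nat_recr //= -big_mkcond.
under eq_fun do rewrite big_mkcond big_nat_recr //= -big_mkcond /=.
apply: poly_cvgM; first by apply: IHj => k /andP[ik kj]; apply: pl; rewrite ik ltnW.
by case: (a j); [apply/poly_cvgXsubC/pl; rewrite ij leqnn | exact: poly_cvg_cst].
Qed.

Lemma poly_cvg_prim f q : poly_cvg F f q -> poly_cvg F (fun t => prim (f t)) (prim q).
Proof.
move=> [[d [fd qd]] fq]; split.
  by exists d.+1; split => [t|]; apply: (leq_trans (size_poly _ _)); rewrite ltnS.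
move=> i; rewrite coef_prim; under eq_fun do rewrite coef_prim.
by apply: cvgM => //; exact: cvg_cst.
Qed.

Lemma horner_cvg f q (g : T -> R) (l : R) : poly_cvg F f q -> g @ F --> l ->
  (f t).[g t] @[t --> F] --> q.[l].
Proof.
move=> [[d [fd qd]] fq] gl; rewrite (horner_coef_wide _ qd).
under eq_fun do rewrite (horner_coef_wide _ (fd _)).
apply: cvg_sum_ord => i _; apply: cvgM => //.
exact: (cvg_comp _ _ gl (@exprn_continuous _ _ _)).
Qed.

End PolyCvg.

Section Gaps.
Variables (R : realType) (a : nat -> bool) (m : nat) (c : R).
Hypothesis c_gt0 : 0 < c.
Implicit Types (x y : 'rV[R]_m).

Lemma cvg_rV (T : Type) (F : set_system T) {FF : Filter F} n (f : T -> 'rV[R]_n) (l : 'rV[R]_n) :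
  (forall j, f t 0 j @[t --> F] --> l 0 j) -> f @ F --> l.
Proof.
move=> fl A [P lP PA].
have : \forall t \near F, forall j, P 0 j (f t 0 j).
  by apply: filter_forall => j; apply: fl; exact: lP.
by apply: filterS => t Pt; apply: PA => i j; rewrite ord1.
Qed.

(* Measured from the last point, so that equal gaps from index k+1 on give equal
   positions from index k+1 on. *)
Definition pos x (i : nat) : R := - \sum_(j < m | (i <= j)%N) x 0 j.

(** For increasing p this is the absolute difference of consecutive values, since the sign is that
    of the derivative between the two points. *)
Definition vdiff (p : nat -> R) (j : nat) : R :=
  let f := prim (c *: crit a 0 m.+1 p) in
  (-1) ^+ nmark a j.+1 m.+1 * (f.[p j.+1] - f.[p j]).

Lemma posS x (j : 'I_m) : pos x j.+1 - pos x j = x 0 j.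
Proof.
rewrite /pos opprK addrC (bigD1 j) //=; apply/eqP; rewrite subr_eq addrC; apply/eqP.
by rewrite addrC; congr (_ + _); apply: eq_bigl => i; rewrite ltn_neqAle andbC eq_sym.
Qed.

Lemma pos_lt x i j : (forall k, 0 < x 0 k) -> (i < j <= m)%N -> pos x i < pos x j.
Proof.
move=> x0 /andP[ij]; elim: j ij => // j IHj; rewrite ltnS leq_eqVlt => ij jm.
have h : pos x j < pos x j.+1 by rewrite -subr_gt0 (posS x (Ordinal jm)).
by case/predU1P: ij => [->//|/IHj/(_ (ltnW jm))/lt_trans]; apply.
Qed.

Lemma pos_last x : pos x m = 0.
Proof. by rewrite /pos big1 ?oppr0 // => j; rewrite leqNgt ltn_ord. Qed.

Lemma cvg_pos (T : Type) (F : set_system T) {FF : Filter F} (f : T -> 'rV[R]_m) x i :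
  f @ F --> x -> pos (f t) i @[t --> F] --> pos x i.
Proof.
move=> fx; apply: cvgN; apply: cvg_sum_ord => j _.
exact: (cvg_comp f (fun M : 'rV[R]_m => M 0 j) fx (@coord_continuous _ _ _ _ _ x)).
Qed.

Lemma cvg_vdiff (T : Type) (F : set_system T) {FF : Filter F} (p : T -> nat -> R) (l : nat -> R) j :
  (j < m)%N -> (forall k, (k <= m)%N -> p t k @[t --> F] --> l k) ->
  vdiff (p t) j @[t --> F] --> vdiff l j.
Proof.
move=> jm pl; apply: cvgM; first exact: cvg_cst.
have fl : poly_cvg F (fun t => prim (c *: crit a 0 m.+1 (p t))) (prim (c *: crit a 0 m.+1 l)).
  by apply/poly_cvg_prim/poly_cvgZ/poly_cvg_crit => k /andP[_ km]; exact: pl.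
by apply: cvgB; apply: horner_cvg => //; apply: pl => //; exact: ltnW.
Qed.

(* Interpolates between the identity (k = 0) and the map from the gaps of the
   points to the absolute differences of consecutive values (k = m). *)
Definition mixed k x : 'rV[R]_m :=
  \row_j (if (j < k)%N then vdiff (pos x) j else x 0 j).

Lemma mixed_continuous k : continuous (mixed k).
Proof.
move=> x; apply: (@cvg_rV _ (nbhs x) _) => j; rewrite mxE; under eq_fun do rewrite mxE.
case: ifP => _; last exact: coord_continuous.
by apply: cvg_vdiff => // i _; apply: cvg_pos; exact: cvg_id.
Qed.

Lemma vdiff_bounds x (j : 'I_m) : (forall k, 0 < x 0 k) ->
  c * (x 0 j / 3) ^+ (nmark a 0 m.+1).+1 <= vdiff (pos x) j
    <= c * (\sum_k x 0 k) ^+ nmark a 0 m.+1 * x 0 j.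
Proof.
move=> x0; have := @crit_diff_bounds R a m (pos x) (prim (c *: crit a 0 m.+1 (pos x))) c j
  c_gt0 (deriv_prim _) (fun i k => @pos_lt x i k x0) (ltn_ord j).
by rewrite posS pos_last /pos sub0r opprK.
Qed.

Lemma mixed_local_inj k x0 : (k < m)%N -> (forall j, 0 < x0 0 j) ->
  exists2 U, nbhs x0 U &
    forall x y, U x -> U y -> mixed k.+1 x = mixed k.+1 y -> x = y.
Proof.
(* On U the midpoints of the points of x0 separate positions of different index, so any two members
   of U interlace as [crit_local_inj] requires. *)
move=> km x00; pose mid (i j : nat) := (pos x0 i + pos x0 j) / 2.
pose U := [set x | forall ij : 'I_m.+1 * 'I_m.+1, (ij.1 < ij.2)%N ->
  pos x ij.1 < mid ij.1 ij.2 < pos x ij.2].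
have posc i : pos x i @[x --> x0] --> pos x0 i by apply: (@cvg_pos _ (nbhs x0) _ id); exact: cvg_id.
exists U.
  apply: (@filter_forall _ _ (fun ij : 'I_m.+1 * 'I_m.+1 => [set x | (ij.1 < ij.2)%N ->
    pos x ij.1 < mid ij.1 ij.2 < pos x ij.2]) (nbhs x0) _) => -[i j] /=; case ij : (i < j)%N; last by apply: nearW.
  have ijm : (i < j <= m)%N by rewrite ij -ltnS ltn_ord.
  have [lt1 lt2] := midf_lt (pos_lt x00 ijm).
  near=> x => _; apply/andP; split; near: x.
    exact: (cvgr_lt (pos x0 i)).
  exact: (cvgr_gt (pos x0 j)).
move=> x y Ux Uy xy.
have Um z1 z2 i j : U z1 -> U z2 -> (i < j <= m)%N -> pos z1 i < pos z2 j.
  move=> Uz1 Uz2 /andP[ij jm]; have im : (i < m.+1)%N by exact: ltn_trans ij _.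
  have /andP[h _] := Uz1 (Ordinal im, Ordinal (jm : (j < m.+1)%N)) ij.
  have /andP[_ h'] := Uz2 (Ordinal im, Ordinal (jm : (j < m.+1)%N)) ij.
  exact: lt_trans h h'.
have eqpos i : (i <= m)%N -> pos x i = pos y i.
  have mxyE (j : 'I_m) : mixed k.+1 x 0 j = mixed k.+1 y 0 j by rewrite xy.
  apply: (crit_local_inj c_gt0 (deriv_prim _) (deriv_prim _) _ km).
  - by move=> i' j' ij; split; exact: Um.
  - move=> {}i /andP[ki im]; congr (- _); apply: eq_bigr => j ij.
    by have := mxyE j; rewrite !mxE ltnNge (leq_trans ki ij).
  - move=> {}i ik; have im := leq_ltn_trans ik km.
    by have := mxyE (Ordinal im); rewrite !mxE /= ltnS ik => /mulfI; apply; rewrite signr_eq0.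
by apply/rowP => j; rewrite -!posS !eqpos // ltnW.
Unshelve. all: by end_near. Qed.

End Gaps.

(** * Locally injective functions on the positive half-line *)

Section LocallyInjective.
Variable R : realType.
Implicit Types (f : R -> R).

(** A level slightly below the maximum is attained on both sides of e, arbitrarily close to it. *)
Lemma no_interior_max f a b e :
    (forall s, a <= s <= b -> {for s, continuous f}) -> a < e < b ->
    (forall s, a <= s <= b -> f s <= f e) ->
  ~ exists2 U, nbhs e U & forall s t, U s -> U t -> f s = f t -> s = t.
Proof.
move=> cf /andP[ae eb] fe [U [r /= r0 rU] Uinj].
pose d := Num.min (r / 2) (Num.min (e - a) (b - e)).
have d0 : 0 < d by rewrite !lt_min divr_gt0 // !subr_gt0 ae eb.
have [dr dea dbe] : [/\ d <= r / 2, d <= e - a & d <= b - e].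
  by split; rewrite /d !ge_min lexx ?orbT.
have inU s : e - d <= s <= e + d -> U s.
  move=> /andP[h1 h2]; apply: rU; rewrite /ball /= ltr_norml; apply/andP; split; lra.
have inab s : e - d <= s <= e + d -> a <= s <= b.
  by move=> /andP[h1 h2]; apply/andP; split; lra.
have cfw u v : e - d <= u -> v <= e + d -> {within `[u, v], continuous f}.
  move=> du vd; apply: continuous_in_subspaceT => s; rewrite inE /= in_itv /= => /andP[us sv].
  by apply: cf; apply: inab; rewrite (le_trans du) // (le_trans sv).
have lt_fe s : e - d <= s <= e + d -> s != e -> f s < f e.
  move=> sd se; rewrite lt_neqAle fe ?inab // andbT; apply: contra_neq se => fse.
  by apply: Uinj fse; apply: inU => //; apply/andP; split; lra.
have dd : e - d < e < e + d by apply/andP; split; lra.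
have [v [v1 v2 v_lt]] : exists v, [/\ f (e - d) <= v, f (e + d) <= v & v < f e].
  exists (Num.max (f (e - d)) (f (e + d))); split; rewrite ?le_max ?lexx ?orbT //.
  case/andP: dd => h1 h2; have h3 := ltW (lt_trans h1 h2).
  by rewrite gt_max !lt_fe ?lexx ?h3 // ?(lt_eqF h1) ?(gt_eqF h2).
have [|||s1 + fs1] := @IVT _ f (e - d) e v.
- lra.
- by apply: cfw; lra.
- by rewrite ge_min v1 le_max (ltW v_lt) orbT.
rewrite in_itv /= => /andP[s1l s1e].
have [|||s2 + fs2] := @IVT _ f e (e + d) v.
- lra.
- by apply: cfw; lra.
- by rewrite ge_min v2 le_max (ltW v_lt) orbT.
rewrite in_itv /= => /andP[s2e s2r].
have s12 : s1 = s2.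
  by apply: Uinj; rewrite ?fs1 ?fs2 //; apply: inU; apply/andP; split; lra.
have s1E : s1 = e by apply/eqP; rewrite eq_le s1e s12 s2e.
by move: fs1 v_lt; rewrite s1E => ->; rewrite ltxx.
Qed.

(** Equal values at s < t force an interior extremum, excluded for f and for - f, or a constant
    function. *)
Lemma locally_injective_inj f :
    (forall s : R, 0 < s -> {for s, continuous f}) ->
    (forall s : R, 0 < s -> exists2 U, nbhs s U & forall u v, U u -> U v -> f u = f v -> u = v) ->
  forall s t : R, 0 < s -> 0 < t -> f s = f t -> s = t.
Proof.
move=> cf linj s t s0 t0; wlog st : s t s0 t0 / s < t.
  by move=> H; case: (ltgtP s t) => [/H|/H h /esym/h ->|//] //; apply.
move=> fst; exfalso.
have pos u : s <= u <= t -> 0 < u by move=> /andP[/(lt_le_trans s0)].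
have cst u : s <= u <= t -> {for u, continuous f} by move=> /pos; exact: cf.
have cw : {within `[s, t], continuous f}.
  by apply: continuous_in_subspaceT => u; rewrite inE /= in_itv /= => /cst.
have [u + fu] := EVT_max (ltW st) cw; rewrite in_itv /= => /andP[su ut].
have fu' z : s <= z <= t -> f z <= f u by move=> zst; apply: fu; rewrite in_itv.
have [v + fv] := EVT_min (ltW st) cw; rewrite in_itv /= => /andP[sv vt].
have fv' z : s <= z <= t -> f v <= f z by move=> zst; apply: fv; rewrite in_itv.
have [sm mt] := midf_lt st.
have ends w : s <= w -> w <= t -> ~~ (s < w < t) -> f w = f s.
  move=> sw wt; rewrite negb_and -!leNgt => /orP[ws|tw].
    by congr f; apply/eqP; rewrite eq_le sw ws.
  by rewrite fst; congr f; apply/eqP; rewrite eq_le wt tw.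
have linjN (w : R) : 0 < w -> exists2 U, nbhs w U & forall u v, U u -> U v -> - f u = - f v -> u = v.
  by move=> /linj[U wU Uinj]; exists U => // ? ? ? ? /oppr_inj; exact: Uinj.
case su' : (s < u < t).
  by apply: (no_interior_max cst su' fu'); apply: linj; apply: pos; rewrite su ut.
case sv' : (s < v < t).
  apply: (@no_interior_max (fun z => - f z) s t v _ sv').
  - by move=> z zst; apply: cvgN; exact: cst.
  - by move=> z zst; rewrite lerN2 fv'.
  - by apply: linjN; apply: pos; rewrite sv vt.
(* Both extrema lie at the ends, where the values agree, so f is constant and the midpoint is a
   maximum. *)
have cst0 z : s <= z <= t -> f z = f s.
  move=> zst; apply/eqP; rewrite eq_le -{1}(ends u) ?su' // fu' //=.
  by rewrite -(ends v) ?sv' // fv'.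
apply: (@no_interior_max f s t ((s + t) / 2) cst).
- by rewrite sm mt.
- by move=> z zst; rewrite !cst0 // !ltW.
- by apply: linj; apply: pos; rewrite !ltW.
Qed.

End LocallyInjective.

(** * Inversion one coordinate at a time *)

Section Inverse.
Variables (R : realType) (a : nat -> bool) (m : nat) (c : R).
Hypothesis c_gt0 : 0 < c.
Implicit Types (x y t : 'rV[R]_m).
Local Notation mixed := (mixed a c).
Local Notation T := (nmark a 0 m.+1).

Definition posrv x := forall j, 0 < x 0 j.

Lemma mixed_gt0 k x : posrv x -> posrv (mixed k x).
Proof.
move=> x0 j; rewrite mxE; case: ifP => // _.
have /andP[+ _] := vdiff_bounds a c_gt0 j x0; apply: lt_le_trans.
by rewrite mulr_gt0 // exprn_gt0 // divr_gt0.
Qed.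

(** A difference at most M gives (x_j/3)^(T+1) <= M/c, and a number above 1 is at most its
    powers. *)
Lemma le_of_mixed k x M j : posrv x -> 0 <= M -> (mixed k x) 0 j <= M ->
  x 0 j <= M + 3 * (1 + M / c).
Proof.
move=> x0 M0; have Mc : 0 <= M / c by rewrite divr_ge0 // ltW.
rewrite mxE; case: ifP => _ h; last by apply: (le_trans h); lra.
have /andP[+ _] := vdiff_bounds a c_gt0 j x0 => /le_trans/(_ h).
rewrite -ler_pdivlMl // [_ * M]mulrC => h'.
case: (leP (x 0 j / 3) (1 + M / c)) => [|h2]; first lra.
have : x 0 j / 3 <= (x 0 j / 3) ^+ T.+1 by apply: ler_eXnr => //; lra.
by move=> /le_trans/(_ h') h3; move: h2 => /(le_lt_trans _); lra.
Qed.

(** Used backwards: when the gaps are bounded, an image entry away from 0 keeps the gap away from 0.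
    The summand 1 serves the entries that are still gaps. *)
Lemma mixed_le k x M j : posrv x -> (forall i, x 0 i <= M) ->
  (mixed k x) 0 j <= (c * (m%:R * M) ^+ T + 1) * x 0 j.
Proof.
move=> x0 xM; have M0 : 0 <= M by exact: le_trans (ltW (x0 j)) (xM j).
rewrite mxE mulrDl mul1r; case: ifP => _.
  apply: ler_wpDr; first exact: ltW.
  have /andP[_ +] := vdiff_bounds a c_gt0 j x0; move/le_trans; apply.
  rewrite ler_wpM2r ?(ltW (x0 _)) // ler_wpM2l ?(ltW c_gt0) // lerXn2r ?nnegrE //.
  - by apply: sumr_ge0 => i _; exact: ltW.
  - by rewrite mulr_ge0.
  - apply: (@le_trans _ _ (\sum_(i < m) M)); first exact: ler_sum.
    by rewrite sumr_const card_ord mulr_natl.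
by apply: ler_wpDl => //; rewrite !mulr_ge0 ?exprn_ge0 ?mulr_ge0 ?(ltW c_gt0) // ltW.
Qed.

(* The map is proper over the positive orthant, by [le_of_mixed] and [mixed_le]. *)
Lemma inverse_continuous k (H : 'rV[R]_m -> 'rV[R]_m) t0 :
    (forall t, posrv t -> posrv (H t) /\ mixed k (H t) = t) ->
    (forall x y, posrv x -> posrv y -> mixed k x = mixed k y -> x = y) ->
  posrv t0 -> {for t0, continuous H}.
Proof.
move=> HP inj t00 U; rewrite nbhsE /= => -[V [oV VH] VU].
have [d d0 dt0] : exists2 d : R, 0 < d & forall j, d < t0 0 j.
  have : \forall d \near 0^'+, forall j, d < t0 0 j.
    by apply: filter_forall => j; exact: nbhs_right_lt.
  move=> /(filterI (@nbhs_right_gt R 0)) /filter_ex[d [/= d0 dt]]; by exists d.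
pose M := \sum_j t0 0 j + 1.
have M0 : 0 <= M by rewrite /M addr_ge0 // sumr_ge0 // => j _; exact: ltW.
have t0M j : t0 0 j < M.
  rewrite /M (bigD1 j) //= -addrA ltrDl ltr_wpDl //.
  by rewrite sumr_ge0 // => i _; exact: ltW.
pose M' := M + 3 * (1 + M / c); pose B := c * (m%:R * M') ^+ T + 1.
have M'0 : 0 <= M' by have : 0 <= M / c by [rewrite divr_ge0 // ltW]; rewrite /M'; lra.
have B0 : 0 < B by rewrite ltr_wpDl // mulr_ge0 ?exprn_ge0 ?mulr_ge0 // ltW.
(* This compact box contains [H t] whenever the entries of t lie between d and M. The image of its
   part outside V is closed and misses t0, so [H t] lies in V for t near t0. *)
pose K := [set x : 'rV[R]_m | forall j, [set` `[d / B, M']] (x 0 j)].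
have cK : compact K by exact: (@rV_compact R m (fun=> [set` `[d / B, M']]) (fun=> @segment_compact _ _ _)).
have cKV : compact (K `&` ~` V) by apply: compact_closedI => //; exact: open_closedC.
have clK : closed (mixed k @` (K `&` ~` V)).
  apply: compact_closed; first exact: norm_hausdorff.
  apply: continuous_compact => //; apply: continuous_subspaceT; exact: mixed_continuous.
have Kpos x : K x -> posrv x.
  move=> Kx j; have := Kx j; rewrite /= in_itv /= => /andP[+ _].
  by apply: lt_le_trans; rewrite divr_gt0.
have nt0 : ~ (mixed k @` (K `&` ~` V)) t0.
  move=> [x [Kx nVx] xt0]; apply: nVx; have [H0 HE] := HP _ t00.
  by rewrite (inj x (H t0)) //; [exact: Kpos | rewrite HE].
have near1 : \forall t \near t0, ~ (mixed k @` (K `&` ~` V)) t.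
  have := closed_openC clK; rewrite openE => /(_ t0 nt0); exact.
have near2 : nbhs t0 [set t : 'rV[R]_m | forall j, d < t 0 j < M].
  apply: (@filter_forall _ _ (fun j => [set t : 'rV[R]_m | d < t 0 j < M]) (nbhs t0) _) => j.
  have ct : (fun t : 'rV[R]_m => t 0 j) @ t0 --> t0 0 j by exact: coord_continuous.
  near=> t; apply/andP; split; near: t.
    exact: (cvgr_gt (t0 0 j)).
  exact: (cvgr_lt (t0 0 j)).
apply: (@filterS _ (nbhs t0) _ _ _ _ (filterI near1 near2)) => t [nt tdM].
have tpos : posrv t by move=> j; case/andP: (tdM j) => /(lt_trans d0).
have [H0 HE] := HP t tpos; apply: VU; apply: contrapT => nV.
apply: nt.
exists (H t) => //; split => // j; rewrite /= in_itv /=.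
have HM i : H t 0 i <= M'.
  by apply: (@le_of_mixed k) => //; rewrite HE; case/andP: (tdM i) => _ /ltW.
rewrite HM andbT ler_pdivrMr // mulrC.
by have := @mixed_le k (H t) M' j H0 HM; rewrite HE; apply: le_trans; case/andP: (tdM j) => /ltW.
Unshelve. all: by end_near. Qed.

(** Induction on k. With H the inverse of [mixed k], the composite of H and [mixed k.+1] changes
    only coordinate k, on each line by the function [phi t]; bijectivity of [phi t] on the positive
    half-line is what has to be shown. *)
Lemma mixed_bijective k : (k <= m)%N ->
  (forall t, posrv t -> exists x, posrv x /\ mixed k x = t) /\
  (forall x y, posrv x -> posrv y -> mixed k x = mixed k y -> x = y).
Proof.
elim: k => [_|k IHk km].
  have m0 x : mixed 0 x = x by apply/rowP => j; rewrite mxE.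
  by split => [t t0|x y _ _]; [exists t; rewrite m0 | rewrite !m0].
have [ex inj] := IHk (ltnW km).
have /choice[H HP'] : forall t, exists x, posrv t -> posrv x /\ mixed k x = t.
  move=> t; have [/ex[x xt]|nt] := pselect (posrv t); first by exists x.
  by exists t.
have HP t : posrv t -> posrv (H t) /\ mixed k (H t) = t by exact: HP'.
have Hc t : posrv t -> {for t, continuous H} by exact: inverse_continuous HP inj.
pose ok := Ordinal km.
pose upd t s : 'rV[R]_m := \row_j (if j == ok then s else t 0 j).
have updP t (s : R) : posrv t -> 0 < s -> posrv (upd t s).
  by move=> t0 s0 j; rewrite mxE; case: ifP.
pose phi t s := vdiff a m c (pos (H (upd t s))) k.
have mixedS t (s : R) : posrv t -> 0 < s -> mixed k.+1 (H (upd t s)) = upd t (phi t s).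
  move=> t0 s0; have [_ E] := HP _ (updP t s t0 s0).
  apply/rowP => j; rewrite !mxE ltnS leq_eqVlt -val_eqE /=.
  case: eqP => [->|jk] //=; have := congr1 (fun x : 'rV[R]_m => x 0 j) E; rewrite !mxE.
  by rewrite -val_eqE /=; case: eqP => // _; case: ifP.
have upd_cvg t s : upd t u @[u --> s] --> upd t s.
  apply: (@cvg_rV _ _ (nbhs s) _) => j; rewrite mxE; under eq_fun do rewrite mxE.
  by case: ifP => _; [exact: cvg_id | exact: cvg_cst].
have Hupd t (s : R) : posrv t -> 0 < s -> H (upd t u) @[u --> s] --> H (upd t s).
  by move=> t0 s0; apply: (cvg_comp _ _ (upd_cvg t s)); apply: Hc; exact: updP.
have phic t (s : R) : posrv t -> 0 < s -> {for s, continuous (phi t)}.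
  move=> t0 s0; apply: (@cvg_vdiff _ _ _ _ _ (nbhs s)) => // i _.
  by apply: cvg_pos; exact: Hupd.
have updk t s : upd t s 0 ok = s by rewrite mxE eqxx.
have Hok t (s : R) : posrv t -> 0 < s -> H (upd t s) 0 ok = s.
  move=> t0 s0; have [_ E] := HP _ (updP t s t0 s0).
  by have := congr1 (fun z : 'rV[R]_m => z 0 ok) E; rewrite mxE /= ltnn updk.
have phi_inj t (s u : R) : posrv t -> 0 < s -> 0 < u -> phi t s = phi t u -> s = u.
  move=> t0; apply: locally_injective_inj; first by move=> v v0; exact: phic.
  move=> v v0; have [Hv0 _] := HP _ (updP t v t0 v0).
  have [U UH Uinj] := mixed_local_inj a c_gt0 km Hv0.
  exists ([set w | U (H (upd t w))] `&` [set w | 0 < w]).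
    by apply: filterI; [exact: Hupd | exact: lt_nbhsr].
  move=> w1 w2 [U1 p1] [U2 p2] E; suff HE : H (upd t w1) = H (upd t w2).
    by have := Hok t w1 t0 p1; rewrite HE Hok.
  by apply: Uinj => //; rewrite !mixedS // E.
have pE t (s : R) : posrv t -> 0 < s -> mixed k.+1 (H (upd t s)) 0 ok = phi t s.
  by move=> t0 s0; rewrite mixedS // updk.
split=> [t t0|x y x0 y0 xy]; last first.
  have upE z : posrv z -> z = H (upd (mixed k.+1 z) (z 0 ok)).
    move=> z0; have [] := HP (upd (mixed k.+1 z) (z 0 ok)).
      by apply: updP => //; exact: mixed_gt0.
    move=> Hz0 HzE; apply: inj => //; rewrite HzE; apply/rowP => j; rewrite !mxE.
    case: (j =P ok) => [->|/eqP jk]; first by rewrite /= ltnn.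
    rewrite [(j < k.+1)%N]ltnS [(j <= k)%N]leq_eqVlt.
    by rewrite -[nat_of_ord j == k]/(j == ok) (negbTE jk).
  have mx0 : posrv (mixed k.+1 x) by exact: mixed_gt0.
  have : phi (mixed k.+1 x) (x 0 ok) = phi (mixed k.+1 x) (y 0 ok).
    by rewrite -!pE // -upE // xy -upE // xy.
  by move=> /phi_inj E; rewrite (upE x) // (upE y) // xy E // -xy.
pose v := t 0 ok; have v0 : 0 < v := t0 ok.
(* For s <= 1 the entries of [upd t s] are at most M, so the gaps are at most M' and [phi t s] is at
   most B s. *)
have [s1 [s10 le1]] : exists s, 0 < s /\ phi t s <= v.
  pose M := \sum_j t 0 j + 1.
  have M0 : 0 <= M by rewrite /M addr_ge0 // sumr_ge0 // => j _; exact: ltW.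
  have tM j : t 0 j <= M.
    rewrite /M (bigD1 j) //= -addrA lerDl addr_ge0 //.
    by rewrite sumr_ge0 // => i _; exact: ltW.
  pose M' := M + 3 * (1 + M / c); pose B := c * (m%:R * M') ^+ T + 1.
  have M'0 : 0 <= M' by have : 0 <= M / c by [rewrite divr_ge0 // ltW]; rewrite /M'; lra.
  have B0 : 0 < B by rewrite ltr_wpDl // mulr_ge0 ?exprn_ge0 ?mulr_ge0 // ltW.
  exists (Num.min 1 (v / B)); set s := Num.min _ _.
  have s0 : 0 < s by rewrite lt_min ltr01 divr_gt0.
  have [sv s1] : s <= v / B /\ s <= 1 by rewrite !ge_min !lexx orbT.
  split => //; have [H0 HE] := HP _ (updP t s t0 s0).
  have HM i : H (upd t s) 0 i <= M'.
    apply: (@le_of_mixed k) => //; rewrite HE mxE; case: ifP => _ //.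
    apply: (le_trans s1); rewrite /M -[leLHS]add0r lerD2r sumr_ge0 // => j _; exact: ltW.
  rewrite -pE //; apply: (le_trans (mixed_le k.+1 ok H0 HM)).
  by rewrite Hok // -/B mulrC -ler_pdivlMr.
(* At s = 3 (1 + v/c) the lower bound c (s/3)^(T+1) is at least c (1 + v/c). *)
have [s2 [s20 le2]] : exists s, 0 < s /\ v <= phi t s.
  have vc : 0 <= v / c by rewrite divr_ge0 // ltW.
  pose s := 3 * (1 + v / c); have s0 : 0 < s by rewrite /s; lra.
  exists s; split => //; have [H0 _] := HP _ (updP t s t0 s0).
  have /andP[+ _] := vdiff_bounds a c_gt0 ok H0; apply: le_trans.
  rewrite Hok // /s mulrAC divff ?mul1r // -ler_pdivrMl // mulrC.
  apply: (@le_trans _ _ (1 + v / c)); first by lra.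
  by apply: ler_eXnr => //; lra.
have [s s0 sv] : exists2 s : R, 0 < s & phi t s = v.
  have ivt (u1 u2 : R) : 0 < u1 -> u1 <= u2 ->
      Num.min (phi t u1) (phi t u2) <= v <= Num.max (phi t u1) (phi t u2) ->
      exists2 s : R, 0 < s & phi t s = v.
    move=> u10 u12 uv; have [|s + ?] := IVT u12 _ uv.
      apply: continuous_in_subspaceT => u; rewrite inE /= in_itv /= => /andP[/(lt_le_trans u10) u0 _].
      exact: phic.
    by rewrite in_itv /= => /andP[/(lt_le_trans u10) s0 _]; exists s.
  case: (leP s1 s2) => s12.
    by apply: (ivt s1 s2) => //; rewrite ge_min le1 le_max le2 orbT.
  by apply: (ivt s2 s1) => //; [exact: ltW | rewrite ge_min le1 orbT le_max le2].
exists (H (upd t s)); split; first by have [] := HP _ (updP t s t0 s0).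
rewrite mixedS // sv; apply/rowP => j; rewrite mxE; by case: eqP => // ->.
Qed.

End Inverse.

(** * The pieces of the space of morsifications *)

Section Edges.
Local Open Scope nat_scope.

(** Whether the edge entering letter j ascends; edge 0 comes from infinity, and edge [size s] leaves
    the last letter towards +oo. *)
Definition edge (e : bool) (s : seq nat) j :=
  if j is j'.+1 then (j == size s) || (nth 0 s j' < nth 0 s j) else e.

Lemma nth_turns e s i : i < size s ->
  nth false (turns e s) i = edge e s i (+) edge e s i.+1.
Proof.
case: s => // x s; rewrite /turns ltnS => is_.
have sz : size (rcons (pairmap ltn x s) true) = (size s).+1 by rewrite size_rcons size_pairmap.
have nthE j : j <= size s -> nth false (rcons (pairmap ltn x s) true) j = edge e (x :: s) j.+1.
  move=> js; rewrite nth_rcons size_pairmap /= eqSS.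
  case: ltngtP js => // js _; first by rewrite (nth_pairmap 0).
rewrite (nth_pairmap false) ?sz // -nthE //.
by case: i is_ => //= i /ltnW is_; rewrite nthE.
Qed.

Lemma nmark_nth (t : seq bool) : nmark (nth false t) 0 (size t) = count id t.
Proof.
by rewrite /nmark -[in RHS](mkseq_nth false t) count_map /index_iota subn0 sum1_count.
Qed.

(** Read from the right: the last edge ascends, and each turn reverses the direction. *)
Lemma odd_nmark_turns e s j : 0 < size s -> j <= size s ->
  odd (nmark (nth false (turns e s)) j (size s)) = ~~ edge e s j.
Proof.
move=> s0 js; rewrite -(subKn js); elim: (size s - j) (leq_subr j (size s)) => [|r IHr] rs.
  by rewrite subn0 /nmark big_geq // /edge -(prednK s0) eqxx.
have lt_s : size s - r.+1 < size s by rewrite ltn_subrL s0.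
rewrite nmark_ltn // oddD -subSn // subSS IHr ?(ltnW rs) // nth_turns // -subSn // subSS.
by case: (edge _ _ _); case: (edge _ _ _).
Qed.

Lemma turns_of_edges (b : nat -> bool) e s i :
    (forall j, j <= size s -> edge e s j = ~~ odd (nmark b j (size s))) -> i < size s ->
  nth false (turns e s) i = b i.
Proof.
move=> eb is_; rewrite nth_turns // !eb // ?(ltnW is_) // (nmark_ltn b is_) oddD.
by rewrite oddb; case: (b i); case: (odd _).
Qed.

End Edges.

Lemma eq_nmark (a b : nat -> bool) i j : (forall k, (i <= k < j)%N -> a k = b k) ->
  nmark a i j = nmark b i j.
Proof.
move=> ab; rewrite /nmark big_nat_cond [RHS]big_nat_cond; apply: eq_bigl => k.
by apply: andb_id2l => /ab.
Qed.

Lemma nmark_card (a : nat -> bool) N : nmark a 0 N = #|[set i : 'I_N | a i]%SET|.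
Proof. by rewrite /nmark big_mkord sum1_card cardsE. Qed.

Section Rank.
Variables (R : realType) (N : nat) (y : 'I_N -> R).

Lemma rank_proof (i : 'I_N) : (#|[set j | (y j < y i)%R]%SET| < N)%N.
Proof.
have : [set j | y j < y i]%SET \proper [set: 'I_N]%SET.
  by rewrite properT; apply/negP => /eqP/setP/(_ i); rewrite !inE ltxx.
by move/proper_card; rewrite cardsT card_ord.
Qed.

Definition rank (i : 'I_N) : 'I_N := Ordinal (rank_proof i).

Lemma rank_lt i j : (rank i < rank j)%N = (y i < y j).
Proof.
apply/idP/idP => [|yij] /=.
  apply: contraLR; rewrite -leNgt -leqNgt => yji.
  by apply: subset_leq_card; apply/fintype.subsetP => k; rewrite !inE => /lt_le_trans; apply.
apply: proper_card; apply/properP; split.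
  by apply/fintype.subsetP => k; rewrite !inE => /lt_trans; apply.
by exists i; rewrite !inE ?ltxx.
Qed.

End Rank.

Section Pieces.
Variables (R : realType) (n l m : nat).
Hypotheses (n_gt0 : (0 < n)%N) (nlm : (n.-1 + l = m.+1)%N).

Definition piece_index := (m.+1.-tuple 'I_m.+1 * {ffun 'I_l -> 'I_m.+1})%type.
Implicit Types (w : m.+1.-tuple 'I_m.+1) (L : {ffun 'I_l -> 'I_m.+1}).

(** The turning letters are to be the critical points. A monic polynomial of degree n comes from -oo
    exactly when n is odd. *)
Definition mask w : nat -> bool := nth false (turns (odd n) (map val w)).

Definition good (wL : piece_index) :=
  [&& wL.1 \in turn_tuples m.+1 (odd n) n.-1, injectiveb wL.2 &
      [forall i, ~~ mask wL.1 (wL.2 i)]].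

(* The pairs whose critical and boundary points, sorted as p 0 < ... < p m, have
   values ordered like the word w, the k-th boundary point being p (L k). *)
Definition piece (wL : piece_index) : set ('rV[R]_(n.-2) * 'rV[R]_l) :=
  [set P : 'rV[R]_(n.-2) * 'rV[R]_l | exists p : nat -> R, let f := Ppoly n P.1 in
    [/\ forall i j, (i < j <= m)%N -> p i < p j,
        f^`() = n%:R *: crit (mask wL.1) 0 m.+1 p,
        forall k, P.2 0 k = p (wL.2 k) &
        forall i j : 'I_m.+1, (f.[p i] < f.[p j]) = (tnth wL.1 i < tnth wL.1 j)%N]].

Lemma nmark_mask w : w \in turn_tuples m.+1 (odd n) n.-1 -> nmark (mask w) 0 m.+1 = n.-1.
Proof.
rewrite inE => /andP[_ /eqP <-]; rewrite /mask /nturns -nmark_nth; congr (nmark _ _ _).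
by rewrite size_turns size_map size_tuple.
Qed.

(** The labels inject into the unmarked indices, of which there are exactly l, so they fill them. *)
Lemma goodP wL : good wL -> [/\ uniq wL.1, nmark (mask wL.1) 0 m.+1 = n.-1,
   injective wL.2 & forall i : 'I_m.+1, ~~ mask wL.1 i = (i \in codom wL.2)].
Proof.
move=> /and3P[w_ /injectiveP Linj /forallP nm].
have nE := nmark_mask w_; split => //; first by move: w_; rewrite inE => /andP[].
suff /eqP E : [set i in codom wL.2]%SET == [set i : 'I_m.+1 | ~~ mask wL.1 i]%SET.
  by move=> i; have /setP/(_ i) := E; rewrite !inE.
rewrite eqEcard; apply/andP; split.
  by apply/fintype.subsetP => i; rewrite !inE => /codomP[k ->].
have -> : #|[set i in codom wL.2]%SET| = l by rewrite cardsE card_codom // card_ord.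
rewrite -(leq_add2l n.-1) nlm -{1}nE nmark_card.
rewrite (_ : [set i : 'I_m.+1 | ~~ mask wL.1 i]%SET = ~: [set i : 'I_m.+1 | mask wL.1 i]%SET).
  by rewrite cardsC card_ord.
by apply/setP => i; rewrite !inE.
Qed.

(** Ascents and descents dictated by the marks b determine all edges, hence all turns; the total n-1
    fixes the edge from infinity. *)
Lemma mask_of_signs w (b : nat -> bool) : nmark b 0 m.+1 = n.-1 ->
    (forall j (jm : (j < m)%N),
      (tnth w (Ordinal (ltnW jm : (j < m.+1)%N)) < tnth w (Ordinal (jm : (j.+1 < m.+1)%N)))%N
       = ~~ odd (nmark b j.+1 m.+1)) ->
  forall i, (i <= m)%N -> mask w i = b i.
Proof.
move=> bn wb i im; have sw : size (map val w) = m.+1 by rewrite size_map size_tuple.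
apply: turns_of_edges; rewrite sw //; case=> [_|j jm] /=.
  by rewrite bn -[in LHS](prednK n_gt0) oddS.
rewrite sw; move: jm; rewrite leq_eqVlt eqSS => /predU1P[->|jm].
  by rewrite eqxx /nmark big_geq.
rewrite ltnS in jm; rewrite ltn_eqF //= -wb !(tnth_nth ord0) !(nth_map ord0) ?size_tuple //.
exact: ltnW.
Qed.

Lemma signs_of_mask w j (jm : (j < m)%N) :
  (tnth w (Ordinal (ltnW jm : (j < m.+1)%N)) < tnth w (Ordinal (jm : (j.+1 < m.+1)%N)))%N
    = ~~ odd (nmark (mask w) j.+1 m.+1).
Proof.
have sw : size (map val w) = m.+1 by rewrite size_map size_tuple.
have := @odd_nmark_turns (odd n) (map val w) j.+1; rewrite sw => -> //; last exact: ltnW.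
by rewrite negbK /= sw eqSS ltn_eqF //= !(tnth_nth ord0) !(nth_map ord0) ?size_tuple // ltnW.
Qed.

Lemma crit_map_filter (a : nat -> bool) N (p : nat -> R) :
  crit a 0 N p = \prod_(x <- [seq p (val i) | i <- [seq i : 'I_N <- enum 'I_N | a i]]) ('X - x%:P).
Proof. by rewrite big_map big_filter /crit big_mkord big_enum_cond. Qed.

Lemma piece_sub_very_nice wL : good wL -> piece wL `<=` @very_nice R n l.
Proof.
move=> gwL; have [uw nE Linj Lc] := goodP gwL.
move=> P [p [pp f' bE ford]]; set f := Ppoly n P.1 in f' ford *.
pose J := [seq i : 'I_m.+1 <- enum 'I_m.+1 | mask wL.1 i].
have sJ : size [seq p (val i) | i <- J] == n.-1.
  by rewrite size_map size_filter -sum1_count big_enum_cond /= -nE /nmark big_mkord.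
exists (Tuple sJ); split; first by rewrite f' crit_map_filter.
have -> : [seq f.[P.2 0 i] | i <- enum 'I_l] = [seq f.[p (val i)] | i <- [seq wL.2 k | k <- enum 'I_l]].
  by rewrite -[RHS]map_comp; apply/eq_in_map => k _ /=; rewrite bE.
rewrite /= -map_comp -map_cat map_inj_uniq.
  rewrite cat_uniq filter_uniq ?enum_uniq // map_inj_uniq ?enum_uniq // andbT /=.
  apply/hasPn => _ /mapP[k _ ->]; rewrite mem_filter negb_and.
  by rewrite Lc codom_f.
move=> i j /= fij; have h1 := ford i j; have h2 := ford j i.
have : val (tnth wL.1 i) = val (tnth wL.1 j).
  by move: h1 h2; rewrite fij ltxx; case: ltngtP.
by move=> /val_inj /(tuple_uniqP _ uw).
Qed.

Lemma very_nice_sub_piece P : very_nice P -> exists2 wL, good wL & piece wL P.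
Proof.
move=> [c [f' uf]]; set f := Ppoly n P.1 in f' uf.
pose pts0 := c ++ [seq P.2 0 i | i <- enum 'I_l].
(* Points with distinct values are distinct. *)
have upts0 : uniq pts0 by apply: (@map_uniq _ _ (horner f)); rewrite map_cat -map_comp.
have [ub bNc] : uniq [seq P.2 0 i | i <- enum 'I_l] /\
    forall x, x \in [seq P.2 0 i | i <- enum 'I_l] -> x \notin c.
  by move: upts0; rewrite cat_uniq => /and3P[_ /hasPn bNc ->]; split => // x /bNc.
pose pts := sort <=%R pts0.
have ptsE : perm_eq pts pts0 by rewrite perm_sort.
have upts : uniq pts by rewrite (perm_uniq ptsE).
have szpts : size pts = m.+1.
  by rewrite (perm_size ptsE) size_cat size_tuple size_map size_enum_ord.
pose p i := nth 0 pts i; pose a i := p i \in c.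
have pp i j : (i < j <= m)%N -> p i < p j.
  move=> /andP[ij jm]; have : sorted <%R pts by rewrite lt_sorted_uniq_le upts sort_le_sorted.
  by move/(sorted_ltn_nth lt_trans 0) => /(_ i j); rewrite !inE szpts; apply => //; exact: (ltn_trans ij).
have f'a : f^`() = n%:R *: crit a 0 m.+1 p.
  rewrite f'; congr (_ *: _).
  rewrite /crit -(big_map p (fun x => x \in c) (fun x => 'X - x%:P)).
  rewrite (_ : map p _ = pts); last by rewrite -[RHS](mkseq_nth 0) szpts /index_iota subn0.
  rewrite (perm_big _ ptsE) big_cat /= -big_seq [X in _ * X]big1_seq ?mulr1 // => x /andP[xc xb].
  by have := bNc x xb; rewrite xc.
have na : nmark a 0 m.+1 = n.-1.
  apply: succn_inj; rewrite -(size_crit _ _ _ p).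
  move: f'; rewrite f'a => /scalerI ->; rewrite ?pnatr_eq0 -?lt0n //.
  by rewrite size_prod_XsubC size_tuple.
have fp_inj : injective (fun i : 'I_m.+1 => f.[p i]).
  have : uniq [seq f.[x] | x <- pts].
    by rewrite (perm_uniq (perm_map _ ptsE)) map_cat -[X in _ ++ X]map_comp.
  move=> /(uniqP 0) h i j /= fij; apply: val_inj.
  apply: h; rewrite ?inE ?size_map ?szpts; [exact: ltn_ord|exact: ltn_ord|].
  by rewrite !(nth_map 0) ?szpts ?ltn_ord.
pose w : m.+1.-tuple 'I_m.+1 := [tuple rank (fun i : 'I_m.+1 => f.[p i]) i | i < m.+1].
have ford (i j : 'I_m.+1) : (f.[p i] < f.[p j]) = (tnth w i < tnth w j)%N.
  by rewrite !tnth_mktuple rank_lt.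
have maskE i : (i <= m)%N -> mask w i = a i.
  apply: mask_of_signs => // j jm; rewrite -ford /=.
  have n0 : 0 < n%:R :> R by rewrite ltr0n.
  have /andP[+ _] := crit_diff_bounds n0 f'a pp jm.
  have d0 : 0 < n%:R * ((p j.+1 - p j) / 3) ^+ (nmark a 0 m.+1).+1.
    by rewrite mulr_gt0 // exprn_gt0 // divr_gt0 // subr_gt0 pp // ltnSn.
  move=> /(lt_le_trans d0); rewrite -signr_odd; case: (odd _).
    by rewrite expr1 mulN1r opprB subr_gt0 => /ltW/le_gtF.
  by rewrite expr0 mul1r subr_gt0.
have Lmem (k : 'I_l) : P.2 0 k \in pts.
  by rewrite (perm_mem ptsE) mem_cat map_f ?orbT // mem_enum.
have Lm (k : 'I_l) : (index (P.2 ord0 k) pts < m.+1)%N by rewrite -szpts index_mem.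
pose L : {ffun 'I_l -> 'I_m.+1} := [ffun k => Ordinal (Lm k)].
have LE k : p (L k) = P.2 0 k by rewrite ffunE /p nth_index.
exists (w, L); last first.
  exists p; split => //.
  by rewrite f'a; congr (_ *: _); apply: eq_crit => // k; rewrite ltnS => /maskE.
apply/and3P; split.
- rewrite inE; apply/andP; split.
    apply/tuple_uniqP => i j wij; apply: fp_inj; apply/eqP.
    by rewrite eq_le !leNgt !ford wij ltnn.
  rewrite -na /nturns -nmark_nth size_turns size_map size_tuple.
  by apply/eqP/eq_nmark => k; rewrite ltnS => /maskE.
- apply/injectiveP => k k' /= /(congr1 (fun i : 'I_m.+1 => p i)); rewrite !LE.
  have binj : injective (fun i : 'I_l => P.2 0 i) by apply/injectiveP; exact: ub.
  exact: binj.
- apply/forallP => k /=; rewrite maskE -1?ltnS // /a LE.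
  by apply: bNc; rewrite map_f // mem_enum.
Qed.

(** The set of points consists of the roots of the derivative and the boundary points, so P
    determines p. The letters are then ranks of values, and the labels follow from injectivity of
    p. *)
Lemma piece_disjoint wL wL' P : good wL -> good wL' -> piece wL P -> piece wL' P -> wL = wL'.
Proof.
move=> g g' [p [pp f' bE ford]] [q [qq g'' bE' ford']]; set f := Ppoly n P.1 in f' ford g'' ford'.
have key vL r : good vL -> f^`() = n%:R *: crit (mask vL.1) 0 m.+1 r ->
    (forall k, P.2 0 k = r (vL.2 k)) ->
    forall x, (x \in [seq r i | i <- iota 0 m.+1]) = root f^`() x || [exists k, x == P.2 0 k].
  move=> gv fr br x; have [_ _ _ Lc] := goodP gv.
  have n0 : n%:R != 0 :> R by rewrite pnatr_eq0 -lt0n.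
  rewrite fr rootZ //; apply/mapP/orP => [[i]|[/root_crit[k [km _ ->]]|/existsP[k /eqP ->]]].
  - rewrite mem_iota add0n => im ->; case mi : (mask vL.1 i).
      by left; apply/root_crit; exists i.
    right; have : (Ordinal im : 'I_m.+1) \in codom vL.2 by rewrite -Lc /= mi.
    by move=> /codomP[k kE]; apply/existsP; exists k; rewrite br -kE.
  - by exists k => //; rewrite mem_iota.
  - by exists (val (vL.2 k)) => //; rewrite mem_iota add0n ltn_ord.
have pq : [seq p i | i <- iota 0 m.+1] = [seq q i | i <- iota 0 m.+1].
  have st r : (forall i j, (i < j <= m)%N -> r i < r j) -> sorted <%R [seq r i | i <- iota 0 m.+1].
    move=> rr; apply: (@homo_sorted_in _ _ (mem (iota 0 m.+1)) r ltn); last exact: iota_ltn_sorted.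
      move=> i j _ jI ij; have jm : j \in iota 0 m.+1 := jI.
      by apply: rr; rewrite [(i < j)%N]ij; move: jm; rewrite mem_iota add0n ltnS.
    exact/allP.
  apply: lt_sorted_eq; rewrite ?st // => x.
  by rewrite (key _ _ g f' bE) (key _ _ g' g'' bE').
have {}pq i : (i <= m)%N -> p i = q i.
  move=> im; have := congr1 (nth 0 ^~ i) pq.
  by rewrite !(nth_map 0%N) ?size_iota // !nth_iota.
have wlt (i j : 'I_m.+1) : (tnth wL.1 i < tnth wL.1 j)%N = (tnth wL'.1 i < tnth wL'.1 j)%N.
  by rewrite -ford -ford' !pq // -ltnS.
have wE : wL.1 = wL'.1.
  have card_lt (w : m.+1.-tuple 'I_m.+1) i : uniq w ->
      val (tnth w i) = #|[set j | (tnth w j < tnth w i)%N]%SET|.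
    move=> uw; have winj := tuple_uniqP _ uw.
    rewrite -[RHS](card_imset _ winj).
    have -> : [set tnth w j | j in [set j | (tnth w j < tnth w i)%N]]%SET =
        [set k : 'I_m.+1 | (k < tnth w i)%N]%SET.
      have [v wv vw] := injF_bij winj.
      apply/setP => k; rewrite inE; apply/imsetP/idP => [[j]|kw]; first by rewrite inE => ? ->.
      by exists (v k); rewrite ?inE vw.
    by rewrite cardsE -sum1_card (big_ord_narrow (ltnW (ltn_ord (tnth w i)))) sum1_card card_ord.
  apply: eq_from_tnth => i; apply: val_inj.
  have [[uw _ _ _] [uw' _ _ _]] := (goodP g, goodP g').
  rewrite (card_lt wL.1 i uw) (card_lt wL'.1 i uw').
  by apply: eq_card => j; rewrite !inE wlt.
have LE : wL.2 = wL'.2.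
  apply/ffunP => k; have := bE k; rewrite bE' -pq; last by rewrite -ltnS.
  have pinj (i j : 'I_m.+1) : p i = p j -> i = j.
    move=> pij; apply: val_inj; case: (ltngtP i j) => // [ij|ji].
      by have := pp i j; rewrite ij -ltnS ltn_ord pij ltxx => /(_ isT).
    by have := pp j i; rewrite ji -ltnS ltn_ord pij ltxx => /(_ isT).
  by move/pinj.
by rewrite [wL]surjective_pairing wE LE -surjective_pairing.
Qed.

End Pieces.

(** * The pieces are open *)

Section PieceTopology.
Variables (R : realType) (n l m : nat).
Hypotheses (n_gt0 : (0 < n)%N) (nlm : (n.-1 + l = m.+1)%N).
Local Notation piece := (@piece R n l m).
Local Notation good := (@good n l m).
Local Notation X := ('rV[R]_(n.-2) * 'rV[R]_l)%type.

Lemma Ppoly_coef (lam : 'rV[R]_(n.-2)) i :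
  (Ppoly n lam)`_i = (i == n)%:R + \sum_(j < n.-2 | i == (n.-2 - j)%N) lam 0 j.
Proof.
rewrite /Ppoly gtn_eqF // coefD coefXn coef_sum; congr (_ + _).
rewrite [RHS]big_mkcond /=; apply: eq_bigr => j _; rewrite coefZ coefXn.
by case: eqP; rewrite ?mulr1 ?mulr0.
Qed.

Lemma size_Ppoly (lam : 'rV[R]_(n.-2)) : size (Ppoly n lam) = n.+1.
Proof.
rewrite /Ppoly gtn_eqF // size_polyDl size_polyXn // ltnS.
apply: (leq_trans (size_sum _ _ _)); apply/bigmax_leqP => i _.
apply: (leq_trans (size_scale_leq _ _)); rewrite size_polyXn.
by have := ltn_ord i; lia.
Qed.

Lemma Ppoly_monic (lam : 'rV[R]_(n.-2)) : (Ppoly n lam)`_n = 1.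
Proof.
rewrite Ppoly_coef eqxx big1 ?addr0 // => j /eqP.
by have := ltn_ord j; lia.
Qed.

Lemma poly_cvg_deriv (T : Type) (F : set_system T) {FF : Filter F} (f : T -> {poly R}) q :
  poly_cvg F f q -> poly_cvg F (fun t => (f t)^`()) q^`().
Proof.
move=> [[d [fd qd]] fq]; split.
  by exists d; split => [t|]; apply: (leq_trans (size_poly _ _)); apply: (leq_trans (leq_pred _)).
move=> i; rewrite coef_deriv -mulr_natr; under eq_fun do rewrite coef_deriv -mulr_natr.
by apply: cvgM => //; exact: cvg_cst.
Qed.

Lemma poly_cvg_Ppoly (T : Type) (F : set_system T) {FF : Filter F} (g : T -> 'rV[R]_(n.-2)) lam :
  g @ F --> lam -> poly_cvg F (fun t => Ppoly n (g t)) (Ppoly n lam).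
Proof.
move=> gl; split; first by exists n.+1; split => [t|]; rewrite size_Ppoly.
move=> i; rewrite Ppoly_coef; under eq_fun do rewrite Ppoly_coef.
apply: cvgD; first exact: cvg_cst.
apply: cvg_sum_ord => j _.
exact: (cvg_comp g (fun M : 'rV[R]_(n.-2) => M 0 j) gl (@coord_continuous _ _ _ _ _ lam)).
Qed.

Lemma crit_sign_change (a : nat -> bool) (p : nat -> R) i d :
    (forall j k, (j < k <= m)%N -> p j + d < p k) -> 0 < d -> (i <= m)%N -> a i ->
  (crit a 0 m.+1 p).[p i - d] * (crit a 0 m.+1 p).[p i + d] < 0.
Proof.
move=> pd d0 im ai.
have ltd j k : (j < k <= m)%N -> p j < p k - d by move=> /pd; rewrite ltrBrDr.
have lt0 j k : (j < k <= m)%N -> p j < p k by move=> /pd; apply: lt_trans; rewrite ltrDl.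
have s1 : 0 < (-1) ^+ nmark a i m.+1 * (crit a 0 m.+1 p).[p i - d].
  apply: crit_sign_gt0 => // [|j ji|j /andP[]]; first exact: leqW.
    by apply: ltd; rewrite ji.
  rewrite leq_eqVlt => /predU1P[<- _|ij]; first by rewrite ltrBlDr ltrDl.
  by rewrite ltnS => jm; rewrite ltrBlDr (lt_trans (lt0 i j _)) ?ij // ltrDl.
have s2 : 0 < (-1) ^+ nmark a i.+1 m.+1 * (crit a 0 m.+1 p).[p i + d].
  apply: crit_sign_gt0 => // [j|j /andP[ij jm]].
    rewrite ltnS leq_eqVlt => /predU1P[->|ji]; first by rewrite ltrDl.
    by rewrite (lt_trans (lt0 j i _)) ?ji // ltrDl.
  by apply: pd; rewrite ij.
move: s1 s2; rewrite nmark_ltn // ai add1n -signr_odd -[_ ^+ nmark a i.+1 _]signr_odd oddS.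
case: (odd _); rewrite /= ?expr0 ?expr1 ?mul1r ?mulN1r ?oppr_gt0 => u v.
  by rewrite pmulr_rlt0.
by rewrite nmulr_rlt0.
Qed.

(** Critical points are simple: the derivative changes sign across each, which persists nearby and
    yields a nearby critical point. The strict inequalities between values persist when the
    polynomial and the points move together. *)
Lemma piece_open wL : good wL -> open (piece wL).
Proof.
move=> gwL; have [uw nE Linj Lc] := goodP nlm gwL.
rewrite openE => P0 [p0 [pp f' bE ford]]; rewrite /interior.
pose v0 : 'rV[R]_m.+1 := \row_i p0 i.
have near1 : nbhs (P0, v0) [set z : X * 'rV[R]_m.+1 | forall ij : 'I_m.+1 * 'I_m.+1,
    (tnth wL.1 ij.1 < tnth wL.1 ij.2)%N ->
    (Ppoly n z.1.1).[z.2 0 ij.1] < (Ppoly n z.1.1).[z.2 0 ij.2]].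
  apply: (@filter_forall _ _ (fun ij => [set z : X * 'rV[R]_m.+1 |
    (tnth wL.1 ij.1 < tnth wL.1 ij.2)%N ->
    (Ppoly n z.1.1).[z.2 0 ij.1] < (Ppoly n z.1.1).[z.2 0 ij.2]]) (nbhs (P0, v0)) _) => -[i j] /=.
  case wij : (_ < _)%N; last by apply: nearW.
  have c1 : (fun z : X * 'rV[R]_m.+1 => z.1.1) @ (nbhs (P0, v0)) --> P0.1.
    by apply: (cvg_comp _ _ (@cvg_fst _ _ _ _ _)); exact: cvg_fst.
  have c2 k : (fun z : X * 'rV[R]_m.+1 => z.2 0 k) @ (nbhs (P0, v0)) --> p0 (val k).
    have -> : p0 (val k) = v0 0 k by rewrite mxE.
    apply: (cvg_comp (fun z : X * 'rV[R]_m.+1 => z.2) (fun M : 'rV[R]_m.+1 => M 0 k) (@cvg_snd _ _ _ _ _)).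
    exact: (@coord_continuous _ _ _ _ _ v0).
  have c3 k : (fun z : X * 'rV[R]_m.+1 => (Ppoly n z.1.1).[z.2 0 k]) @ (nbhs (P0, v0)) -->
      (Ppoly n P0.1).[p0 (val k)].
    by apply: horner_cvg; [exact: poly_cvg_Ppoly | exact: c2].
  have c4 := cvgB (c3 j) (c3 i).
  have lt0 : 0 < (Ppoly n P0.1).[p0 (val j)] - (Ppoly n P0.1).[p0 (val i)].
    by rewrite subr_gt0 ford wij.
  have FF : Filter (nbhs (P0, v0)) := nbhs_filter _.
  have c5 := cvgr_gt _ (c4 FF) _ lt0.
  by apply: (@filterS _ (nbhs (P0, v0)) FF _ _ _ (c5 FF)) => z /=; rewrite subr_gt0.
have [[U1 U2] /= [nU1 nU2] U12] := near1.
have [e /= e0 eU2] : exists2 e : R, 0 < e &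
    forall p : 'rV[R]_m.+1, (forall i, `|p 0 i - p0 i| < e) -> U2 p.
  have /nbhs_ballP[e /= e0 eU2] := nU2; exists e => // p pe.
  by apply: eU2; split => // i j; rewrite ord1 /ball /= mxE distrC.
(* Points moved by less than d stay in order, as the gaps exceed 2 d, and stay in [U2], as d < e. *)
have [d [d0 de dp]] : exists d, [/\ 0 < d, d < e &
    forall j k, (j < k <= m)%N -> p0 j + d + d < p0 k].
  have nd : \forall d \near 0^'+, forall jk : 'I_m.+1 * 'I_m.+1, (jk.1 < jk.2)%N ->
      d < (p0 jk.2 - p0 jk.1) / 2.
    apply: (@filter_forall _ _ (fun jk : 'I_m.+1 * 'I_m.+1 => [set d | (jk.1 < jk.2)%N ->
      d < (p0 jk.2 - p0 jk.1) / 2]) (0^'+) _) => -[j k] /=.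
    case jk : (j < k)%N; last by apply: nearW.
    have h : 0 < (p0 k - p0 j) / 2 by rewrite divr_gt0 // subr_gt0 pp // jk -ltnS ltn_ord.
    by have := nbhs_right_lt h; apply: filterS => x + _.
  have FF : Filter (nbhs (0 : R)^'+) by exact: at_right_proper_filter.
  have := @filterI _ _ FF _ _ (@filterI _ _ FF _ _ (@nbhs_right_gt R 0) (nbhs_right_lt e0)) nd.
  move=> /filter_ex[d [[/= d0 de] dd]]; exists d; split => // j k /andP[jk km].
  have jm : (j < m.+1)%N by exact: (ltn_trans jk).
  by have := dd (Ordinal jm, Ordinal (km : (k < m.+1)%N)) jk; rewrite /=; lra.
have dp1 j k : (j < k <= m)%N -> p0 j + d < p0 k.
  by move=> /dp; apply: lt_trans; rewrite ltrDl.
have n0 : 0 < n%:R :> R by rewrite ltr0n.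
pose der (P : X) := (Ppoly n P.1)^`().
have near2 : nbhs P0 [set P : X | forall i : 'I_m.+1, mask n wL.1 i ->
    (der P).[p0 i - d] * (der P).[p0 i + d] < 0].
  apply: (@filter_forall _ _ (fun i : 'I_m.+1 => [set P : X | mask n wL.1 i ->
    (der P).[p0 i - d] * (der P).[p0 i + d] < 0]) (nbhs P0) _) => i /=.
  case mi : (mask _ _ _); last by apply: nearW.
  have c1 : poly_cvg (nbhs P0) der (der P0).
    by apply/poly_cvg_deriv/poly_cvg_Ppoly; exact: cvg_fst.
  have c2 x : (fun P => (der P).[x]) @ (nbhs P0) --> (der P0).[x].
    by apply: horner_cvg => //; exact: cvg_cst.
  have c3 := cvgM (c2 (p0 i - d)) (c2 (p0 i + d)).
  have lt0 : (der P0).[p0 i - d] * (der P0).[p0 i + d] < 0.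
    rewrite /der f' !hornerZ mulrACA pmulr_rlt0 ?mulr_gt0 //.
    by apply: crit_sign_change => //; rewrite -ltnS.
  have FF : Filter (nbhs P0) := nbhs_filter _.
  have c4 := cvgr_lt _ (c3 FF) _ lt0.
  by apply: (@filterS _ (nbhs P0) FF _ _ _ (c4 FF)) => P /=.
have near3 : nbhs P0 [set P : X | forall k, `|P.2 0 k - P0.2 0 k| < d].
  apply: (@filter_forall _ _ (fun k : 'I_l => [set P : X | `|P.2 0 k - P0.2 0 k| < d]) (nbhs P0) _) => k.
  have c1 : (fun P : X => P.2 0 k) @ (nbhs P0) --> P0.2 0 k.
    apply: (cvg_comp (fun P : X => P.2) (fun M : 'rV[R]_l => M 0 k) (@cvg_snd _ _ _ _ _)).
    exact: (@coord_continuous _ _ _ _ _ P0.2).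
  have FF : Filter (nbhs P0) := nbhs_filter _.
  have /cvgrPdist_lt/(_ d d0) c2 := c1.
  by apply: (@filterS _ (nbhs P0) FF _ _ _ c2) => P /=; rewrite distrC.
apply: (filterS _ (filterI nU1 (filterI near2 near3))) => P [U1P [PN2 PN3]].
have /choice[z zP] : forall i : 'I_m.+1, exists z, [/\ `|z - p0 i| < d,
    mask n wL.1 i -> root (der P) z & forall k, wL.2 k = i -> z = P.2 0 k].
  move=> i; case mi : (mask n wL.1 i).
    have [|x + rx] := @polyrcf.poly_ivtoo _ (der P) (p0 i - d) (p0 i + d) _ (PN2 i mi); first by lra.
    rewrite in_itv /= => /andP[x1 x2]; exists x; split => //.
      by rewrite ltr_norml; apply/andP; split; lra.
    by move=> k ki; have := codom_f wL.2 k; rewrite -Lc ki mi.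
  have : i \in codom wL.2 by rewrite -Lc mi.
  move=> /codomP[k kE]; exists (P.2 0 k); split => //; first by rewrite kE -bE.
  by move=> k' ; rewrite kE => /Linj ->.
pose p i := z (inord i).
have pE (i : 'I_m.+1) : p i = z i by rewrite /p inord_val.
have pd i : (i <= m)%N -> `|p i - p0 i| < d.
  by move=> im; have [+ _ _] := zP (inord i); rewrite inordK.
have pinc i j : (i < j <= m)%N -> p i < p j.
  move=> ij; have := dp i j ij; case/andP: ij => ij jm.
  have := pd i (ltnW (leq_trans ij jm)); have := pd j jm.
  by rewrite !ltr_norml => /andP[? ?] /andP[? ?] ?; lra.
exists p; split => //.
(* The n-1 distinct zeros found exhaust the roots of the derivative, which has degree n-1 and
   leading coefficient n. *)
- pose J := [seq i : 'I_m.+1 <- enum 'I_m.+1 | mask n wL.1 i].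
  have sJ : size [seq p (val i) | i <- J] = n.-1.
    by rewrite size_map size_filter -sum1_count big_enum_cond /= -nE /nmark big_mkord.
  have lc : (der P)`_n.-1 = n%:R by rewrite coef_deriv prednK // Ppoly_monic.
  have sz : size (der P) = n.
    apply/eqP; rewrite eqn_leq; apply/andP; split.
      by apply: (leq_trans (size_poly _ _)); rewrite size_Ppoly.
    by rewrite -[n](prednK n_gt0) ltnNge; apply/negP => /leq_sizeP/(_ _ (leqnn _))/eqP; rewrite lc gt_eqF.
  rewrite crit_map_filter -/J -/(der P).
  rewrite -[in n%:R *: _]lc (_ : (der P)`_n.-1 = lead_coef (der P)); last by rewrite /lead_coef sz.
  apply: all_roots_prod_XsubC.
  + by rewrite sz sJ prednK.
  + apply/allP => _ /mapP[i + ->]; rewrite mem_filter => /andP[mi _].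
    by rewrite pE; have [_ /(_ mi)] := zP i.
  + rewrite uniq_rootsE map_inj_uniq; first exact: (filter_uniq _ (enum_uniq _)).
    move=> i j pij.
    apply: val_inj; case: (ltngtP i j) => // ij.
      by have := pinc i j; rewrite ij -ltnS ltn_ord pij ltxx => /(_ isT).
    by have := pinc j i; rewrite ij -ltnS ltn_ord pij ltxx => /(_ isT).
- by move=> k; rewrite pE; have [_ _ /(_ k erefl)] := zP (wL.2 k).
have Up : U2 (\row_i p i).
  by apply: eU2 => i; rewrite mxE; apply: lt_trans de; apply: pd; rewrite -ltnS.
have lt i j : (tnth wL.1 i < tnth wL.1 j)%N -> (Ppoly n P.1).[p i] < (Ppoly n P.1).[p j].
  by move=> wij; have := U12 (P, \row_i p i) (conj U1P Up) (i, j) wij; rewrite /= !mxE.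
move=> i j; apply/idP/idP; last exact: lt.
apply: contraLR; rewrite -leqNgt leq_eqVlt => /orP[/eqP/val_inj|/lt/ltW].
  by move=> /(tuple_uniqP _ uw) ->; rewrite ltxx.
by rewrite -leNgt.
Qed.
End PieceTopology.

Section GapVectors.
Variables (R : realType) (a : nat -> bool) (m : nat) (c : R).
Implicit Types (p q : nat -> R).

Definition gaps q : 'rV[R]_m := \row_j (q j.+1 - q j).

Lemma pos_gaps q i : (i <= m)%N -> pos (gaps q) i = q i - q m.
Proof.
move=> im; rewrite -(subKn im); elim: (m - i)%N (leq_subr i m) => [|r IHr] rm.
  by rewrite subn0 pos_last subrr.
have jm : (m - r.+1 < m)%N by rewrite ltn_subrL (leq_trans _ rm).
have := posS (gaps q) (Ordinal jm); rewrite mxE /= -subSn // subSS IHr ?(ltnW rm) //.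
by move=> h; lra.
Qed.

Lemma crit_shift i j p u :
  crit a i j (fun k => p k + u) \Po ('X + u%:P) = crit a i j p.
Proof.
rewrite /crit rmorph_prod; apply: eq_bigr => k _.
by rewrite /= comp_polyB comp_polyX comp_polyC polyCD; ring.
Qed.

(** A translate of F and the primitive in [vdiff] have equal derivatives, so they differ by a
    constant, which cancels. *)
Lemma vdiff_shift F p q u j : F^`() = c *: crit a 0 m.+1 q ->
    (forall i, (i <= m)%N -> q i = p i + u) -> (j < m)%N ->
  vdiff a m c p j = (-1) ^+ nmark a j.+1 m.+1 * (F.[q j.+1] - F.[q j]).
Proof.
move=> F' qp jm; rewrite /vdiff; congr (_ * _).
set G := prim _; pose F2 := F \Po ('X + u%:P).
have F2E i : (i <= m)%N -> F.[q i] = F2.[p i].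
  by move=> im; rewrite /F2 horner_comp hornerD hornerX hornerC qp.
have F2' : (G - F2)^`() = 0.
  rewrite derivB deriv_prim /F2 deriv_comp derivD derivX derivC addr0 mulr1 F' comp_polyZ.
  rewrite (_ : crit a 0 m.+1 q = crit a 0 m.+1 (fun k => p k + u)); last first.
    by apply: eq_crit => // k; rewrite ltnS => /qp.
  by rewrite crit_shift subrr.
have := deriv0_horner (p j.+1) (p j) F2'; rewrite !hornerD !hornerN -!F2E // 1?ltnW // => h.
by lra.
Qed.

Lemma mixed_gaps F q : F^`() = c *: crit a 0 m.+1 q ->
  mixed a c m (gaps q) = \row_j ((-1) ^+ nmark a j.+1 m.+1 * (F.[q j.+1] - F.[q j])).
Proof.
move=> F'; apply/rowP => j; rewrite !mxE ltn_ord.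
by apply: (vdiff_shift (u := q m)) => // i im; rewrite pos_gaps // subrK.
Qed.

(** Vieta's formula: the missing term of degree n-1 means that the critical points have sum 0. *)
Lemma coef_crit_pred i j p : (0 < nmark a i j)%N ->
  (crit a i j p)`_(nmark a i j).-1 = - \sum_(i <= k < j | a k) p k.
Proof.
have sE : size [seq p k | k <- index_iota i j & a k] = nmark a i j.
  by rewrite size_map -sum1_size big_filter.
move=> n0; have := @coefPn_prod_XsubC _ [seq p k | k <- index_iota i j & a k].
by rewrite sE !big_map !big_filter -lt0n => /(_ n0).
Qed.

End GapVectors.

(** * The pieces are connected *)

Section PieceConnected.
Variables (R : realType) (n l m : nat).
Hypotheses (n_gt0 : (0 < n)%N) (nlm : (n.-1 + l = m.+1)%N).
Variables (wL : piece_index l m).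
Hypothesis gwL : good n wL.
Local Notation X := ('rV[R]_(n.-2) * 'rV[R]_l)%type.
Local Notation a := (mask n wL.1).
Local Notation c := (n%:R : R).
Local Notation piece := (@piece R n l m wL).
Variable H : 'rV[R]_m -> 'rV[R]_m.
Hypothesis HP : forall t, posrv t -> posrv (H t) /\ mixed a c m (H t) = t.
Hypothesis Hinj : forall x z : 'rV[R]_m, posrv x -> posrv z -> mixed a c m x = mixed a c m z -> x = z.
Implicit Types (y : nat -> R).

Let c_gt0 : 0 < c. Proof. by rewrite ltr0n. Qed.
Let na : nmark a 0 m.+1 = n.-1. Proof. by have [] := goodP nlm gwL. Qed.

Definition ordered y := forall i j : 'I_m.+1, (y i < y j) = (tnth wL.1 i < tnth wL.1 j)%N.

Definition jumps y : 'rV[R]_m :=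
  \row_j ((-1) ^+ nmark a j.+1 m.+1 * (y j.+1 - y j)).

(* The critical points must have sum 0; for n = 1 there are none, and the only
   polynomial is 'X, so that points and values coincide. *)
Definition shift y := if n == 1%N then y m else
  - (\sum_(0 <= i < m.+1 | a i) pos (H (jumps y)) i) / (n.-1)%:R.

Definition points y i := pos (H (jumps y)) i + shift y.

Definition antider y := prim (c *: crit a 0 m.+1 (points y)).

(** Rebuilds a pair from the values at its sorted points: [H] gives the gaps and [shift] the
    translation. *)
Definition realize y : X :=
  (\row_(i < n.-2) (antider y)`_(n.-2 - i), \row_k points y (wL.2 k)).

Lemma jumps_gt0 y : ordered y -> posrv (jumps y).
Proof.
move=> oy j; rewrite mxE; have := signs_of_mask n wL.1 (ltn_ord j); rewrite -oy /=.
rewrite -signr_odd; case: (odd _) => /=.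
  rewrite expr1 mulN1r opprB subr_gt0 => /negbT; rewrite -leNgt le_eqVlt => /predU1P[E|//].
  exfalso; have [uw _ _ _] := goodP nlm gwL.
  pose j1 : 'I_m.+1 := Ordinal (ltnW (ltn_ord j) : (j < m.+1)%N).
  pose j2 : 'I_m.+1 := Ordinal (ltn_ord j : (j.+1 < m.+1)%N).
  have : tnth wL.1 j1 = tnth wL.1 j2.
    apply: val_inj => /=; have := oy j1 j2; have := oy j2 j1; rewrite /= E ltxx.
    by case: ltngtP.
  by move=> /(tuple_uniqP _ uw) /(congr1 val) /= /n_Sn.
by rewrite expr0 mul1r subr_gt0.
Qed.

Lemma sum_points y : n != 1%N -> \sum_(0 <= i < m.+1 | a i) points y i = 0.
Proof.
move=> n1; rewrite /points big_split /= /shift (negbTE n1).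
have -> u : \sum_(0 <= i < m.+1 | a i) u = (n.-1)%:R * u :> R.
  by rewrite -na /nmark natr_sum mulr_suml; apply: eq_bigr => i _; rewrite mul1r.
rewrite mulrCA divff ?mulr1 ?subrr // pnatr_eq0 -lt0n.
by case: (n) n_gt0 n1 => // -[].
Qed.

(** The primitive lies in P_n: its leading coefficient is n/n, its term of degree n-1 vanishes as
    the critical points have sum 0, and it has no constant term. *)
Lemma Ppoly_realize y : Ppoly n (realize y).1 = antider y.
Proof.
apply/polyP => i; rewrite Ppoly_coef // /antider coef_prim coefZ.
have sz := size_crit a 0 m.+1 (points y); rewrite na prednK // in sz.
case: (ltngtP i n) => [lt_in|lt_ni|->]; last first.
- have /monicP := monic_crit a 0 m.+1 (points y); rewrite /lead_coef sz => ->.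
  rewrite mulr1 divff ?gt_eqF // big1 ?addr0 // => j /eqP.
  by have := ltn_ord j; lia.
- rewrite nth_default ?sz; last by rewrite -ltnS (ltn_predK lt_ni).
  rewrite mulr0 mul0r add0r big1 // => j /eqP.
  by have := ltn_ord j; lia.
rewrite add0r; case: i lt_in => [|i] lt_in.
  rewrite invr0 mulr0 big1 // => j /eqP.
  by have := ltn_ord j; lia.
move: lt_in; rewrite -[n in (_ < n)%N](prednK n_gt0) ltnS leq_eqVlt => /predU1P[iE|lt_in].
  rewrite big1 => [|j /eqP]; last by have := ltn_ord j; lia.
  have nn : nmark a 0 m.+1 = i.+1 by rewrite na.
  have -> : (crit a 0 m.+1 (points y))`_i.+1.-1 = 0.
    have := @coef_crit_pred R a 0 m.+1 (points y); rewrite nn => ->//.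
    by rewrite sum_points ?oppr0 //; move: iE; case: (n) => // -[].
  by rewrite mulr0 mul0r.
have jn : (n.-2 - i.+1 < n.-2)%N by rewrite ltn_subrL /=; lia.
rewrite (big_pred1 (Ordinal jn)); last first.
  by move=> j; have jn2 := ltn_ord j; rewrite /= -val_eqE /=; apply/eqP/eqP; lia.
rewrite mxE /= subKn; last by lia.
by rewrite /antider coef_prim coefZ.
Qed.

Lemma realize_val y i : ordered y -> (i <= m)%N ->
  (antider y).[points y i] - y i = (antider y).[points y 0%N] - y 0%N.
Proof.
move=> oy; elim: i => // i IHi im; rewrite -IHi ?(ltnW im) //.
have [_ HE] := HP (jumps_gt0 oy).
have := congr1 (fun x : 'rV[R]_m => x 0 (Ordinal im)) HE; rewrite !mxE /= im.
rewrite (vdiff_shift (deriv_prim (c *: crit a 0 m.+1 (points y))) (u := shift y)) // -/(antider y).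
by move/mulfI; rewrite signr_eq0 => /(_ isT) h; lra.
Qed.

Lemma realize_piece y : ordered y -> piece (realize y).
Proof.
move=> oy; have [H0 _] := HP (jumps_gt0 oy).
exists (points y); rewrite Ppoly_realize; split.
- by move=> i j ij; rewrite ltrD2r pos_lt.
- by rewrite deriv_prim.
- by move=> k; rewrite mxE.
move=> i j; rewrite -oy; have hi := realize_val oy (ltn_ord i : (i <= m)%N).
have hj := realize_val oy (ltn_ord j : (j <= m)%N).
by apply/idP/idP; lra.
Qed.

(** Injectivity of the gap map recovers the gaps of p. The translation follows from the critical
    points having sum 0, or from f = 'X when n = 1. *)
Lemma realizeK (P : X) (p : nat -> R) : let f := Ppoly n P.1 in
    (forall i j, (i < j <= m)%N -> p i < p j) -> f^`() = c *: crit a 0 m.+1 p ->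
    (forall k, P.2 0 k = p (wL.2 k)) -> ordered (fun i => f.[p i]) ->
  realize (fun i => f.[p i]) = P.
Proof.
move=> f pp f' bE oy; set y := fun i => _.
have [H0 HE] := HP (jumps_gt0 oy).
have g0 : posrv (gaps m p) by move=> j; rewrite mxE subr_gt0 pp // ltnSn ltn_ord.
have HG : H (jumps y) = gaps m p by apply: Hinj => //; rewrite HE (mixed_gaps f').
have shE : shift y = p m.
  rewrite /shift; case: ifPn => [/eqP n1|n1].
    rewrite /y (_ : f = 'X) ?hornerX //; apply/polyP => i.
    rewrite Ppoly_coef // coefX big1 ?addr0 => [|j _]; last by have := ltn_ord j; lia.
    by congr (_%:R); congr (i == _).
  have n2 : (1 < n)%N by case: (n) n_gt0 n1 => // -[].
  have sp : \sum_(0 <= i < m.+1 | a i) p i = 0.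
    have nm0 : (0 < nmark a 0 m.+1)%N by rewrite na; lia.
    have := coef_crit_pred p nm0; rewrite na => cE.
    have := congr1 (fun q : {poly R} => q`_n.-2) f'; rewrite coef_deriv coefZ cE Ppoly_coef //.
    rewrite (_ : (_ == n) = false); last by apply/eqP; lia.
    rewrite big1 ?addr0 ?mul0rn => [|j /eqP]; last by have := ltn_ord j; lia.
    by move/esym/eqP; rewrite mulf_eq0 gt_eqF //= oppr_eq0 => /eqP.
  have -> : \sum_(0 <= i < m.+1 | a i) pos (H (jumps y)) i = - ((n.-1)%:R * p m).
    transitivity (\sum_(0 <= i < m.+1 | a i) (p i - p m)).
      rewrite big_nat_cond [RHS]big_nat_cond; apply: eq_bigr => i /andP[/andP[_ im] _].
      by rewrite HG pos_gaps.
    rewrite sumrB sp sub0r -na /nmark natr_sum mulr_suml; congr (- _).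
    by apply: eq_bigr => i _; rewrite mul1r.
  by rewrite opprK mulrAC divff ?mul1r // pnatr_eq0; lia.
have ptE i : (i <= m)%N -> points y i = p i.
  by move=> im; rewrite /points HG pos_gaps // shE subrK.
have fE : antider y = f.
  apply/polyP => i; rewrite /antider (_ : crit a 0 m.+1 (points y) = crit a 0 m.+1 p); last first.
    by apply: eq_crit => // k; rewrite ltnS => /ptE.
  rewrite -f' coef_prim; case: i => [|i].
    rewrite invr0 mulr0 Ppoly_coef // big1 ?addr0 => [|j /eqP].
      by case: (n) n_gt0.
    by have := ltn_ord j; lia.
  by rewrite coef_deriv /= -[_ *+ _]mulr_natr mulfK // pnatr_eq0.
rewrite [RHS]surjective_pairing; congr (_, _).
  apply/rowP => i; rewrite mxE fE Ppoly_coef // (big_pred1 i).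
    by rewrite (_ : (_ == n) = false) ?add0r //; have := ltn_ord i; lia.
  by move=> j /=; rewrite -val_eqE /=; have i_ := ltn_ord i; have j_ := ltn_ord j; apply/eqP/eqP; lia.
by apply/rowP => k; rewrite mxE bE ptE // -ltnS.
Qed.

Lemma realize_cvg (Y : R -> nat -> R) (s0 : R) :
    (forall i, Y s i @[s --> s0] --> Y s0 i) -> {for jumps (Y s0), continuous H} ->
  realize (Y s) @[s --> s0] --> realize (Y s0).
Proof.
move=> cY cH.
have cJ : jumps (Y s) @[s --> s0] --> jumps (Y s0).
  apply: (@cvg_rV _ _ (nbhs s0) _) => j; rewrite mxE; under eq_fun do rewrite mxE.
  by apply: cvgM; [exact: cvg_cst | apply: cvgB; exact: cY].
have cHJ : H (jumps (Y s)) @[s --> s0] --> H (jumps (Y s0)).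
  exact: (cvg_comp (fun s => jumps (Y s)) H cJ cH).
have cpos i : pos (H (jumps (Y s))) i @[s --> s0] --> pos (H (jumps (Y s0))) i.
  exact: cvg_pos.
have csh : shift (Y s) @[s --> s0] --> shift (Y s0).
  rewrite /shift; case: ifP => _; first exact: cY.
  apply: cvgM; last exact: cvg_cst.
  apply: cvgN; rewrite big_mkord; under eq_fun do rewrite big_mkord.
  by apply: cvg_sum_ord => i _; exact: cpos.
have cpt i : points (Y s) i @[s --> s0] --> points (Y s0) i by exact: cvgD.
have cF : poly_cvg (nbhs s0) (fun s => antider (Y s)) (antider (Y s0)).
  by apply/poly_cvg_prim/poly_cvgZ/poly_cvg_crit => k _; exact: cpt.
have c1 : (realize (Y s)).1 @[s --> s0] --> (realize (Y s0)).1.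
  apply: (@cvg_rV _ _ (nbhs s0) _) => j; rewrite mxE; under eq_fun do rewrite mxE.
  by have [_] := cF; apply.
have c2 : (realize (Y s)).2 @[s --> s0] --> (realize (Y s0)).2.
  apply: (@cvg_rV _ _ (nbhs s0) _) => j; rewrite mxE; under eq_fun do rewrite mxE.
  exact: cpt.
exact: (cvg_pair c1 c2).
Qed.

(** Value vectors of a given order type form a convex set; the image under [realize] of the segment
    joining two of them connects P0 to P1. *)
Lemma realize_connected P0 P1 :
    (forall t, posrv t -> {for t, continuous H}) -> piece P0 -> piece P1 ->
  exists C, [/\ C P0, C P1, C `<=` piece & connected C].
Proof.
move=> Hc [p0 [pp0 f0' bE0 o0]] [p1 [pp1 f1' bE1 o1]].
set f0 := Ppoly n P0.1 in f0' o0; set f1 := Ppoly n P1.1 in f1' o1.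
pose y0 i := f0.[p0 i]; pose y1 i := f1.[p1 i].
pose Y (s : R) i := y0 i + s * (y1 i - y0 i).
have oY s : 0 <= s <= 1 -> ordered (Y s).
  move=> /andP[s_ge0 s_le1] i j; rewrite /Y; apply/idP/idP => [|wij]; last first.
    have h0 : y0 i < y0 j by rewrite o0. have h1 : y1 i < y1 j by rewrite o1.
    have [->|s0] := eqVneq s 0; first by rewrite !mul0r !addr0.
    have s_gt0 : 0 < s by rewrite lt_def s0.
    have k1 : 0 <= (1 - s) * (y0 j - y0 i) by rewrite mulr_ge0 ?subr_ge0 // ltW.
    have k2 : 0 < s * (y1 j - y1 i) by rewrite mulr_gt0 // subr_gt0.
    by rewrite -subr_gt0; move: (ltr_wpDl k1 k2); congr (_ < _); ring.
  apply: contraLR => nw; rewrite -leNgt.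
  have h0 : y0 j <= y0 i by rewrite leNgt o0. have h1 : y1 j <= y1 i by rewrite leNgt o1.
  have k1 : 0 <= (1 - s) * (y0 i - y0 j) by rewrite mulr_ge0 ?subr_ge0.
  have k2 : 0 <= s * (y1 i - y1 j) by rewrite mulr_ge0 ?subr_ge0.
  by rewrite -subr_ge0; move: (addr_ge0 k1 k2); congr (_ <= _); ring.
have Y0 : realize (Y 0) = P0.
  have -> : Y 0 = y0 by apply/funext => i; rewrite /Y mul0r addr0.
  by apply: realizeK => // i j; rewrite o0.
have Y1 : realize (Y 1) = P1.
  have -> : Y 1 = y1 by apply/funext => i; rewrite /Y mul1r addrC subrK.
  by apply: realizeK => // i j; rewrite o1.
exists ((fun s => realize (Y s)) @` [set` `[0 : R, 1]]); split.
- by exists 0 => //=; rewrite in_itv /= lexx ler01.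
- by exists 1 => //=; rewrite in_itv /= lexx ler01.
- by move=> _ [s /= + <-]; rewrite in_itv /= => s01; apply/realize_piece/oY.
apply: connected_continuous_connected; first exact: segment_connected.
apply: continuous_in_subspaceT => s; rewrite inE /= in_itv /= => s01.
apply: realize_cvg; last by apply/Hc/jumps_gt0/oY.
move=> i; apply: cvgD; first exact: cvg_cst.
by apply: cvgM; [exact: cvg_id | exact: cvg_cst].
Qed.

End PieceConnected.

Section PieceConnectedness.
Variables (R : realType) (n l m : nat).
Hypotheses (n_gt0 : (0 < n)%N) (nlm : (n.-1 + l = m.+1)%N).

Lemma piece_inverse (a : nat -> bool) : exists H : 'rV[R]_m -> 'rV[R]_m,
  [/\ forall t, posrv t -> posrv (H t) /\ mixed a n%:R m (H t) = t,
     forall x z : 'rV[R]_m, posrv x -> posrv z -> mixed a n%:R m x = mixed a n%:R m z -> x = z &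
     forall t, posrv t -> {for t, continuous H}].
Proof.
have n0 : 0 < n%:R :> R by rewrite ltr0n.
have [ex inj] := mixed_bijective a n0 (leqnn m).
have /choice[H HP'] : forall t : 'rV[R]_m, exists x, posrv t -> posrv x /\ mixed a n%:R m x = t.
  move=> t; have [/ex[x xt]|nt] := pselect (posrv t); first by exists x.
  by exists t.
have HP t : posrv t -> posrv (H t) /\ mixed a n%:R m (H t) = t by exact: HP'.
by exists H; split => // t; exact: (inverse_continuous n0 HP inj).
Qed.

Lemma piece_connected (wL : piece_index l m) : good n wL -> connected (@piece R n l m wL).
Proof.
move=> gwL; have [H [HP Hinj Hc]] := piece_inverse (mask n wL.1).
have [->|/set0P[P0 P0p]] := eqVneq (@piece R n l m wL) set0; first exact: connected0.
rewrite (_ : piece wL = \bigcup_(C in [set C | [/\ C P0, C `<=` @piece R n l m wL & connected C]]) C).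
  apply: bigcup_connected; last by move=> C [].
  by exists P0 => C [].
apply/seteqP; split => [P Pp|P [C [_ + _]]]; last exact.
have [C [C0 CP Cp cC]] := realize_connected n_gt0 nlm gwL HP Hinj Hc P0p Pp.
by exists C.
Qed.

Lemma piece_nonempty (wL : piece_index l m) : good n wL -> @piece R n l m wL !=set0.
Proof.
move=> gwL; have [H [HP _ _]] := piece_inverse (mask n wL.1).
(* The letters of the word themselves serve as values. *)
exists (realize n wL H (fun i => (tnth wL.1 (inord i))%:R)).
by apply: realize_piece => // i j; rewrite !inord_val ltr_nat.
Qed.

End PieceConnectedness.

(** * Counting the components *)

Section CountComponents.
Variables (R : realType) (T : topologicalType) (I : finType) (S : pred I) (V : I -> set T).
Hypotheses (Vc : forall i, S i -> connected (V i)) (V0 : forall i, S i -> V i !=set0)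
  (Vo : forall i, S i -> open (V i))
  (Vd : forall i j x, S i -> S j -> V i x -> V j x -> i = j).

Lemma counting_components (A : set T) : A = \bigcup_(i in [set i | S i]) V i ->
  counting (components A) = (#|S|%:R : R)%:E.
Proof.
move=> AE.
have compE i x : S i -> V i x -> connected_component A x = V i.
  move=> Si Vix; apply/seteqP; split; last first.
    by apply: connected_component_max; [| rewrite AE => y Vy; exists i | exact: Vc].
  move=> y [C [Cx CA Cc] Cy].
  (* The trace of [V i] on the connected set C is open, and closed because the other pieces are
     open. *)
  have : C `&` V i = C; last by move=> CV; move: Cy; rewrite -CV => -[].
  apply: Cc; first by exists x.
    by exists (V i) => //; exact: Vo.
  exists (~` (\bigcup_(j in [set j | S j /\ j != i]) V j)).
    by apply: open_closedC; apply: bigcup_open => j [Sj _]; exact: Vo.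
  apply/seteqP; split => z [Cz Vz]; split => //.
    by move=> [j [Sj /eqP ji] Vjz]; apply: ji; exact: Vd Vjz Vz.
  have := CA z Cz; rewrite AE => -[j Sj Vjz].
  have [<-//|ji] := eqVneq j i.
  by exfalso; apply: Vz; exists j.
have cE : components A = V @` [set i | S i].
  apply/seteqP; split => [_ [x Ax <-]|_ [i Si <-]].
    by move: (Ax); rewrite {1}AE => -[i Si Vix]; exists i => //; rewrite (compE i).
  have [x Vix] := V0 Si; exists x; last exact: compE.
  by rewrite AE; exists i.
have fin : finite_set (V @` [set i | S i]) by apply: finite_image; exact: finite_finset.
rewrite cE /counting asboolT //; congr (_%:R%:E).
have Vinj : {in S &, injective V}.
  by move=> i j Si Sj Vij; have [x Vx] := V0 Si; apply: (Vd Si Sj Vx); rewrite -Vij.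
rewrite cardE -(size_map V); apply: perm_size; apply: uniq_perm.
- exact: finmap.fset_uniq.
- by rewrite map_inj_in_uniq ?enum_uniq // => i j; rewrite !mem_enum; exact: Vinj.
move=> W; rewrite in_fset_set //; apply/idP/mapP => [|[i]].
  by rewrite inE => -[i Si <-]; exists i => //; rewrite mem_enum.
by rewrite mem_enum => Si ->; rewrite inE; exists i.
Qed.

End CountComponents.

Section CountPieces.
Variables (n l m : nat).
Hypotheses (n_gt0 : (0 < n)%N) (nlm : (n.-1 + l = m.+1)%N).

Lemma card_good : #|@good n l m| = (l`! * sectan_coef m.+1 n)%N.
Proof.
rewrite -num_turns_sectan // -card_turn_tuples -[LHS]sum1_card.
pose Q (w : m.+1.-tuple 'I_m.+1) := fun L : {ffun 'I_l -> 'I_m.+1} =>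
  injectiveb L && [forall i, ~~ mask n w (L i)].
rewrite (eq_bigl (fun wL => (wL.1 \in turn_tuples m.+1 (odd n) n.-1) && Q wL.1 wL.2)) //.
rewrite -(pair_big_dep (mem (turn_tuples m.+1 (odd n) n.-1)) Q (fun _ _ => 1%N)) /=.
rewrite mulnC -sum_nat_const; apply: eq_bigr => w ww.
rewrite sum1_card; pose B := [pred i : 'I_m.+1 | ~~ mask n w i].
have cB : #|B| = l.
  apply/eqP; rewrite -(eqn_add2l n.-1) nlm -(nmark_mask ww) nmark_card.
  rewrite -[#|B|]cardsE (_ : [set x in B]%SET = ~: [set i : 'I_m.+1 | mask n w i]%SET).
    by rewrite cardsC card_ord.
  by apply/setP => i; rewrite !inE.
have := @card_inj_ffuns_on 'I_l 'I_m.+1 B; rewrite cB card_ord ffactnn => <-; rewrite cardsE.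
by apply: eq_card => L; rewrite -!topredE /= andbC; congr (_ && _); apply/forallP/ffun_onP.
Qed.

End CountPieces.

(** For n = 0 both sides vanish, as two boundary points share the value 0. Otherwise the components
    are the good pieces. *)
Lemma Kcomp_sectan (R : realType) n l : (1 < l)%N ->
  Kcomp R n l = (l`!%:R * (sectan_coef (n + l).-1 n)%:R : R)%:E.
Proof.
case: n => [|n'] l_gt1.
  have -> : sectan_coef (0 + l).-1 0 = 0%N by case: l l_gt1 => [//|[//|l]] _; elim: l.
  rewrite mulr0 /Kcomp /components (_ : @very_nice R 0 l = set0).
    by rewrite image_set0 /counting asboolT // fset_set0.
  apply/seteqP; split => // P [c /= [_]]; rewrite tuple0 /= => u.
  have /injectiveP inj : injectiveb (fun i : 'I_l => (Ppoly 0 P.1).[P.2 0 i]) by exact: u.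
  have := @inj (Ordinal (ltnW l_gt1)) (Ordinal l_gt1).
  by rewrite /Ppoly eqxx !horner0 => /(_ erefl) /(congr1 val).
set n := n'.+1; have n_gt0 : (0 < n)%N by [].
pose m := (n' + l).-1; have nlm : (n.-1 + l = m.+1)%N.
  by rewrite /m prednK //= addn_gt0 (ltnW l_gt1) orbT.
rewrite /Kcomp (@counting_components R _ _ (good n (l:=l) (m:=m)) (@piece R n l m)).
- by rewrite card_good // natrM -nlm.
- by move=> wL g; exact: piece_connected.
- by move=> wL g; exact: piece_nonempty.
- by move=> wL g; exact: piece_open.
- by move=> wL wL' P g g'; exact: piece_disjoint.
apply/seteqP; split => P.
  by move=> /(very_nice_sub_piece n_gt0 nlm)[wL g wP]; exists wL.
by move=> [wL g wP]; exact: (piece_sub_very_nice nlm g).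
Qed.

(** Read as a formula for [s k j.+2], the recurrence lowers the second index until only the entries
    [s _ 0], the Bernoulli-Euler numbers, remain. *)
Lemma solve_recurrence (R : comNzRingType) (s : nat -> nat -> R) (k : nat) :
    (forall k, s k.+2 0%N = s k 1%N) ->
    (forall k j, s k.+2 j.+1 = (k%:R + 2) * s k.+2 j + (j%:R + 2) * s k j.+2) ->
  [/\ 2 * s k 2%N = s k.+4 0%N - (k%:R + 2) * s k.+2 0%N,
      6 * s k 3%N = s k.+4.+2 0%N - (3 * k%:R + 8) * s k.+4 0%N,
      24 * s k 4%N = s k.+4.+4 0%N - (6 * k%:R + 20) * s k.+4.+2 0%N
        + 3 * (k%:R + 2) * (k%:R + 4) * s k.+4 0%N &
      120 * s k 5%N = s k.+4.+4.+2 0%N - (10 * k%:R + 40) * s k.+4.+4 0%N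
        + (15 * k%:R ^+ 2 + 110 * k%:R + 184) * s k.+4.+2 0%N].
Proof.
move=> s1 sS; have nE i : i.+2%:R = i%:R + 2 :> R by rewrite -addn2 natrD.
have E2 i : 2 * s i 2%N = s i.+4 0%N - (i%:R + 2) * s i.+2 0%N.
  by rewrite (s1 i.+2) sS; ring.
have E3 i : 6 * s i 3%N = s i.+4.+2 0%N - (3 * i%:R + 8) * s i.+4 0%N.
  have -> : 6 * s i 3%N = 2 * s i.+2 2%N - 2 * (i%:R + 2) * s i.+2 1%N by rewrite (sS i 1%N); ring.
  by rewrite E2 -s1 (nE i); ring.
have E4 i : 24 * s i 4%N = s i.+4.+4 0%N - (6 * i%:R + 20) * s i.+4.+2 0%N
    + 3 * (i%:R + 2) * (i%:R + 4) * s i.+4 0%N.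
  have -> : 24 * s i 4%N = 6 * s i.+2 3%N - 3 * (i%:R + 2) * (2 * s i.+2 2%N).
    by rewrite (sS i 2%N); ring.
  by rewrite E2 E3 (nE i); ring.
split => //.
have -> : 120 * s k 5%N = 24 * s k.+2 4%N - 4 * (k%:R + 2) * (6 * s k.+2 3%N).
  by rewrite (sS k 3%N); ring.
by rewrite E3 E4 (nE k); ring.
Qed.

Lemma sectan_coef_rec (k j : nat) :
  (sectan_coef (k.+2 + j.+1).-1 k.+2 =
   k.+2 * sectan_coef (k.+2 + j).-1 k.+2 + j.+2 * sectan_coef (k + j.+2).-1 k)%N.
Proof.
have -> : (k.+2 + j.+1).-1 = (k + j).+2 by lia.
have -> : (k.+2 + j).-1 = (k + j).+1 by lia.
have -> : (k + j.+2).-1 = (k + j).+1 by lia.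
by rewrite sectan_coefS (_ : (k + j).+2 - k = j.+2)%N //; lia.
Qed.

Lemma sectan_coef_rec0 (k : nat) :
  sectan_coef (k.+2 + 0).-1 k.+2 = sectan_coef (k + 1).-1 k.
Proof.
by rewrite addn0 addn1 sectan_coefS sectan_coef_gt // muln0 add0n subSnn mul1n.
Qed.

Theorem corollary4p1 (R : realType) (K : nat -> R) (hK : bernoulli_euler K)
    (n : nat) :
  [/\ Kcomp R n 2 = (K (n + 3)%N - (n + 2)%:R * K (n + 1)%N)%:E,
      Kcomp R n 3 = (K (n + 5)%N - (3 * n + 8)%:R * K (n + 3)%N)%:E,
      Kcomp R n 4 = (K (n + 7)%N - (6 * n + 20)%:R * K (n + 5)%N
                     + (3 * (n + 2) * (n + 4))%:R * K (n + 3)%N)%:E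
    & Kcomp R n 5 = (K (n + 9)%N - (10 * n + 40)%:R * K (n + 7)%N
                     + (15 * n ^ 2 + 110 * n + 184)%:R * K (n + 5)%N)%:E].
Proof.
(* With k the degree and j the number of boundary points, j! s k j counts components for j > 1. *)
pose s k j : R := (sectan_coef (k + j).-1 k)%:R.
have KE j : K (n + j.+1)%N = s (n + j).+2 0%N.
  by rewrite (bernoulli_eulerE _ hK) addnS /s addn0.
have KC j : (1 < j)%N -> Kcomp R n j = (j`!%:R * s n j)%:E by exact: Kcomp_sectan.
have s1 k : s k.+2 0%N = s k 1%N by rewrite /s sectan_coef_rec0.
have sS k j : s k.+2 j.+1 = (k%:R + 2) * s k.+2 j + (j%:R + 2) * s k j.+2.
  by rewrite /s sectan_coef_rec natrD !natrM -addn2 -[j.+2]addn2 !natrD.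
have [E2 E3 E4 E5] := solve_recurrence n s1 sS.
have f2 : 2`! = 2%N by []. have f3 : 3`! = 6%N by [].
have f4 : 4`! = 24%N by []. have f5 : 5`! = 120%N by [].
clearbody s.
by split; rewrite KC // (f2, f3, f4, f5) (E2, E3, E4, E5) !KE !(natrD, natrM, natrX) !addnS !addn0.
Qed.
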